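(* Let $d\ge 2$ and consider the incompressible Euler equations on $\mathbb{T}^d$, $$\partial_t u+u\cdot\nabla u+\nabla p=0,\qquad \nabla\cdot u=0,$$ for the unknown velocity field $u=u(t,x)\in\mathbb{R}^d$ and pressure $p=p(t,x)\in\mathbb{R}$. Let $\rho>0$ and let $u_0$ be a divergence-free vector field in $X_\rho$. Then there exists a constant $C_1$, depending on $u_0$, such that, setting $\rho(t)=\rho-C_1t$, the Cauchy problem for the incompressible Euler equations with initial data $u(0,\cdot)=u_0$ has a solution $u(t)\in X_{\rho(t)}$ for positive times $t$ as long as $\rho(t)$ remains positive.
   Context: For a (scalar- or vector-valued) function $f$ on the torus $\mathbb{T}^d$, with Fourier coefficients $f_\alpha$, $\alpha\in\mathbb{Z}^d$ (so that $f(x)=\sum_{\alpha\in\mathbb{Z}^d} f_\alpha e^{i\alpha\cdot x}$), the generator function of $f$ is $$Gen[f](z)=\sum_{\alpha\in\mathbb{Z}^d} e^{z|\alpha|}\,|f_\alpha|,$$ where $|\alpha|$ is the Euclidean norm of $\alpha$ and $|f_\alpha|$ is the modulus (Euclidean norm for vectors) of $f_\alpha$. For $\rho>0$ the function space $X_\rho$ is $$X_\rho=\{u : Gen[u](\rho)<\infty\}.$$ *)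

(* Defs.v *)
From HB Require Import structures.
From mathcomp Require Import all_boot all_order all_algebra.
From mathcomp Require Import complex.
From mathcomp Require Import all_classical all_reals all_analysis.
From mathcomp.analysis.showcase Require summability.
Import Order.TTheory GRing.Theory Num.Theory numFieldNormedType.Exports.

Set Implicit Arguments.
Unset Strict Implicit.
Unset Printing Implicit Defensive.

Local Open Scope classical_set_scope.
Local Open Scope ring_scope.
Local Open Scope complex_scope.

(* A function on the torus T^d = R^d / (2 pi Z)^d is represented by a
   (2 pi Z)^d-periodic function on 'rV[R]_d. *)
Definition on_torus (R : realType) (d : nat) (T : Type) (f : 'rV[R]_d -> T) :=
  forall (x : 'rV[R]_d) (k : 'rV[int]_d),
    f (x + (2 * pi) *: map_mx intr k) = f x.

(* The library has no Lebesgue measure on R^d, so the integral over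
   [0, 2 pi]^d is iterated; for the continuous functions to which it is applied
   it is the usual integral by Fubini's theorem. *)
Fixpoint torus_integral (R : realType) (d : nat) : ('rV[R]_d -> R) -> R :=
  match d return ('rV[R]_d -> R) -> R with
  | 0 => fun f => f 0
  | d'.+1 => fun f =>
      \int[lebesgue_measure]_(s in `[0%R, 2 * pi])
        torus_integral (fun y : 'rV[R]_d' => f (row_mx (s%:M : 'rV_1) y))
  end.

Definition torus_Cintegral (R : realType) (d : nat) (f : 'rV[R]_d -> R[i]) :
    R[i] :=
  torus_integral (fun x => complex.Re (f x)) +i*
  torus_integral (fun x => complex.Im (f x)).

Definition cis (R : realType) (a : R) : R[i] := cos a +i* sin a.

Definition phase (R : realType) (d : nat) (k : 'rV[int]_d) (x : 'rV[R]_d) : R :=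
  \sum_j (k 0 j)%:~R * x 0 j.

Definition fourier_coef (R : realType) (d m : nat) (f : 'rV[R]_d -> 'rV[R]_m)
    (k : 'rV[int]_d) : 'rV[R[i]]_m :=
  \row_j ((((2 * pi) ^- d)%:C) *
          torus_Cintegral (fun x => (f x 0 j)%:C * cis (- phase k x))).

(* The norm of the library on row vectors is the sup norm. *)
Definition index_norm (R : realType) (d : nat) (k : 'rV[int]_d) : R :=
  Num.sqrt (\sum_j ((k 0 j)%:~R) ^+ 2).

Definition coef_norm (R : realType) (m : nat) (c : 'rV[R[i]]_m) : R :=
  Num.sqrt (\sum_j (Normc.normc (c 0 j)) ^+ 2).

Definition Gen (R : realType) (d m : nat) (f : 'rV[R]_d -> 'rV[R]_m) (z : R) :
    \bar R :=
  (\esum_(k in [set: 'rV[int]_d])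
     (expR (z * index_norm R k) * coef_norm (fourier_coef f k))%:E)%E.

(* Unconditional summation, i.e. convergence along finite sets of indices. *)
Definition sum_of_fourier_series (R : realType) (d m : nat)
    (f : 'rV[R]_d -> 'rV[R]_m) :=
  forall (x : 'rV[R]_d) (j : 'I_m),
    summability.partial_sum
      (fun k : 'rV[int]_d => (fourier_coef f k 0 j * cis (phase k x)) : R[i]^o)
      @ summability.totally --> ((f x 0 j)%:C : R[i]^o).

(* A function in X_rho must be the sum of its Fourier series, not merely have a
   finite generator function: otherwise non-measurable functions, or functions
   altered on a null set, would qualify. *)
Definition Xspace (R : realType) (d m : nat) (rho : R) :
    set ('rV[R]_d -> 'rV[R]_m) :=
  [set f | [/\ on_torus f, sum_of_fourier_series f & (Gen f rho < +oo)%E]].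

Definition basis_vec (R : realType) (d : nat) (j : 'I_d) : 'rV[R]_d :=
  delta_mx 0 j.

Definition divergence (R : realType) (d : nat) (v : 'rV[R]_d -> 'rV[R]_d)
    (x : 'rV[R]_d) : R :=
  \sum_j 'D_(basis_vec R j) (fun y => v y 0 j) x.

Definition divergence_free (R : realType) (d : nat)
    (v : 'rV[R]_d -> 'rV[R]_d) :=
  forall x, divergence v x = 0.

Definition gradient (R : realType) (d : nat) (q : 'rV[R]_d -> R)
    (x : 'rV[R]_d) : 'rV[R]_d :=
  \row_j 'D_(basis_vec R j) q x.

(* (v . nabla) w *)
Definition advection (R : realType) (d : nat) (v w : 'rV[R]_d -> 'rV[R]_d)
    (x : 'rV[R]_d) : 'rV[R]_d :=
  \sum_j v x 0 j *: 'D_(basis_vec R j) w x.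

(* Classical solutions of the Cauchy problem on an interval of times
   J = [0, T[. Regularity: u is continuous on J * R^d; at positive times, u is
   C^1 in (t, x), and p is continuous in (t, x) and C^1 in x. Both are functions
   on the torus; in particular the pressure is required to be periodic. *)
Record euler_solution (R : realType) (d : nat) (J : set R)
    (u0 : 'rV[R]_d -> 'rV[R]_d)
    (u : R -> 'rV[R]_d -> 'rV[R]_d) (p : R -> 'rV[R]_d -> R) : Prop := {
  euler_torus_velocity : forall t, J t -> on_torus (u t) ;
  euler_torus_pressure : forall t, J t -> 0 < t -> on_torus (p t) ;
  euler_velocity_continuous :
    {within J `*` [set: 'rV[R]_d], continuous (fun z => u z.1 z.2)} ;
  euler_velocity_derivable_t : forall t (x : 'rV[R]_d), J t -> 0 < t ->
    derivable (fun s => u s x) t 1 ;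
  euler_velocity_derivable_x : forall t (x : 'rV[R]_d) (j : 'I_d), J t -> 0 < t ->
    derivable (u t) x (basis_vec R j) ;
  euler_velocity_C1_t : forall t (x : 'rV[R]_d), J t -> 0 < t ->
    {for (t, x), continuous (fun z : R * 'rV[R]_d =>
       'D_1 (fun s => u s z.2) z.1)} ;
  euler_velocity_C1_x : forall t (x : 'rV[R]_d) (j : 'I_d), J t -> 0 < t ->
    {for (t, x), continuous (fun z : R * 'rV[R]_d =>
       'D_(basis_vec R j) (u z.1) z.2)} ;
  euler_pressure_continuous : forall t (x : 'rV[R]_d), J t -> 0 < t ->
    {for (t, x), continuous (fun z : R * 'rV[R]_d => p z.1 z.2)} ;
  euler_pressure_derivable_x : forall t (x : 'rV[R]_d) (j : 'I_d), J t -> 0 < t ->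
    derivable (p t) x (basis_vec R j) ;
  euler_pressure_C1_x : forall t (x : 'rV[R]_d), J t -> 0 < t ->
    {for (t, x), continuous (fun z : R * 'rV[R]_d => gradient (p z.1) z.2)} ;
  euler_momentum : forall t (x : 'rV[R]_d), J t -> 0 < t ->
    'D_1 (fun s => u s x) t + advection (u t) (u t) x + gradient (p t) x = 0 ;
  euler_incompressible : forall t, J t -> divergence_free (u t) ;
  euler_initial : u 0 = u0
}.

(* Main.v *)
Require Import Defs.
From HB Require Import structures.
From mathcomp Require Import all_boot all_order all_algebra.
From mathcomp Require Import complex.
From mathcomp Require Import all_classical all_reals all_analysis.
From mathcomp Require Import finmap ring lra.
Import Order.TTheory GRing.Theory Num.Theory numFieldNormedType.Exports.

(** The solution is built as a power series in time,
      u(t, x) = sum over n and k of U(n, k) t^n e^(i k.x),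
    whose coefficients are forced by the equation. Equating the coefficients of
    t^n and projecting on divergence-free fields with the Leray multiplier P
    gives (n + 1) U(n + 1, k) = - P_k N(n, k), where N(n, k), a convolution over
    nat * Z^d, is the coefficient of (u . nabla) u. The pressure coefficients
    are the part of N that the projection removes.

    Everything then rests on a Cauchy-Kovalevskaya estimate. Let A_n(z) be the
    sum over k of e^(z |k|) |U(n, k)|. As |k + l| <= |k| + |l|, the recursion
    bounds (n + 1) A_(n+1)(z) by a multiple of the sum over m of
    A_m(z) A'_(n-m)(z), and A'_m(z) is at most A_m(z') / (z' - z) for z' > z.
    Giving up the fraction 1 / (m + 2) of the remaining radius rho - z for each
    derivative, an induction yields A_n(z) <= M (K / (rho - z))^n / (n + 1)^2
    for 0 <= z < rho (level_norm_bound): the convolution with one factor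
    differentiated loses a factor of order n, which n + 1 compensates, and the
    weights 1 / (n + 1)^2 absorb the number of terms (sum_weights_le).

    Take C1 = 4 K. At time t > 0 and radius z = rho - C1 t, the series of the
    t^n A_n(z) is dominated by a geometric series of ratio K t / (rho - z) = 1/4,
    so that u(t) lies in the space of radius rho(t). On the whole interval of
    times the fixed radius rho / 2 still leaves a convergent series, with room
    for slightly larger times and for derivatives; differentiating term by term,
    multiplying series and comparing coefficients (momentum_coef,
    divergence_coef) gives the equations.

    Two facts about the data are needed as well. The coefficients of an
    absolutely convergent trigonometric series are the Fourier coefficients of
    its sum (fourier_coef_unique). It turns the series above into membership in
    the spaces of the statement, and it transfers to coefficients that the
    initial velocity is real and divergence-free. The symmetry
    U(n, -k) = conjugate of U(n, k) is inherited by the recursion and makes the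
    solution real. *)

Set Implicit Arguments.
Unset Strict Implicit.
Unset Printing Implicit Defensive.

Local Open Scope classical_set_scope.
Local Open Scope ring_scope.
Local Open Scope complex_scope.

Local Notation Re := complex.Re.
Local Notation Im := complex.Im.
Local Notation normc := Normc.normc.

Notation "\esumT_ i F" := (esum setT (fun i => F%E))
  (at level 41, i at level 0, F at level 41, format "\esumT_ i  F").

(** * Unconditional sums *)

Section NonnegSums.
Variable R : realType.
Implicit Types (I J : choiceType).

Lemma esumT_ge0 I (a : I -> \bar R) :
  (forall i, 0 <= a i)%E -> (0 <= \esumT_i a i)%E.
Proof. by move=> a0; exact: esum_ge0. Qed.

Lemma esumT_le I (a b : I -> \bar R) :
  (forall i, a i <= b i)%E -> (\esumT_i a i <= \esumT_i b i)%E.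
Proof. by move=> ab; apply: le_esum => i _. Qed.

Lemma eq_esumT I (a b : I -> \bar R) :
  (forall i, a i = b i) -> \esumT_i a i = \esumT_i b i.
Proof. by move=> ab; apply: eq_esum => i _. Qed.

Lemma esumTD I (a b : I -> \bar R) :
  (forall i, 0 <= a i)%E -> (forall i, 0 <= b i)%E ->
  \esumT_i (a i + b i)%E = (\esumT_i a i + \esumT_i b i)%E.
Proof. by move=> a0 b0; apply: esumD. Qed.

Lemma esumTZ I (c : R) (a : I -> \bar R) : 0 <= c ->
  (forall i, 0 <= a i)%E ->
  \esumT_i (c%:E * a i)%E = (c%:E * \esumT_i a i)%E.
Proof.
move=> c0 a0; rewrite /esum -ereal_supZl //; last first.
  by apply/set0P; exists 0%E; exists set0; [exact: fsets_set0|rewrite fsbig_set0].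
congr ereal_sup; apply/seteqP; split => x.
  move=> [A fA <-]; exists (\sum_(i \in A) a i)%E; first by exists A.
  by rewrite ge0_mule_fsumr.
move=> [_ [A fA <-] <-]; exists A => //.
by rewrite ge0_mule_fsumr.
Qed.

Lemma esumT_reindex I J (e : I -> J) (a : J -> \bar R) :
  bijective e -> \esumT_j a j = \esumT_i a (e i).
Proof.
by move=> be; apply: reindex_esum; rewrite setTT_bijective.
Qed.

Lemma esumT_pair I J (a : I * J -> \bar R) : (forall k, 0 <= a k)%E ->
  \esumT_k a k = \esumT_i \esumT_j a (i, j).
Proof.
move=> a0; rewrite esum_esum //; congr esum.
- by apply/seteqP; split.
- by apply/funext => -[].
Qed.

Lemma esumT_exchange I J (a : I -> J -> \bar R) : (forall i j, 0 <= a i j)%E ->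
  \esumT_i \esumT_j a i j = \esumT_j \esumT_i a i j.
Proof.
move=> a0; rewrite -(@esumT_pair _ _ (fun k => a k.1 k.2)) //.
rewrite -(@esumT_pair _ _ (fun k => a k.2 k.1)) //.
apply: (@esumT_reindex _ _ (fun k : J * I => (k.2, k.1))).
by exists (fun k : I * J => (k.2, k.1)) => -[].
Qed.

Lemma esumT_term I (a : I -> \bar R) i :
  (forall i, 0 <= a i)%E -> (a i <= \esumT_i a i)%E.
Proof.
move=> a0; apply: esum_ge; exists [set i]; last by rewrite fsbig_set1.
by split.
Qed.

Lemma esumT_sum I (J : choiceType) (r : seq J) (a : J -> I -> \bar R) :
  (forall j i, 0 <= a j i)%E ->
  \esumT_i (\sum_(j <- r) a j i)%E = (\sum_(j <- r) \esumT_i a j i)%E.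
Proof. by move=> a0; apply: esum_sum. Qed.

End NonnegSums.

Section RealSums.
Variable R : realType.
Implicit Types (I J : choiceType).

Definition abs_summable I (f : I -> R) := (\esumT_i (`|f i|)%:E < +oo)%E.

Definition nsum I (f : I -> R) : R := fine (\esumT_i (f i)%:E).

Lemma summable_le I (f g : I -> R) :
  (forall i, `|f i| <= g i) -> abs_summable g -> abs_summable f.
Proof.
move=> fg; apply: le_lt_trans; apply: esumT_le => i.
by rewrite lee_fin (le_trans (fg i)) // ler_norm.
Qed.

Lemma summable_abs I (f : I -> R) :
  abs_summable f -> abs_summable (fun i => `|f i|).
Proof.
by congr (_ < _)%E; apply: eq_esumT => i; rewrite normr_id.
Qed.

Lemma summable_fin I (f : I -> R) : (forall i, 0 <= f i) ->
  (\esumT_i (f i)%:E < +oo)%E -> abs_summable f.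
Proof.
by move=> f0; congr (_ < _)%E; apply: eq_esumT => i; rewrite ger0_norm.
Qed.

Lemma nsumE I (f : I -> R) : (forall i, 0 <= f i) -> abs_summable f ->
  \esumT_i (f i)%:E = (nsum f)%:E.
Proof.
move=> f0 sf; rewrite /nsum fineK // ge0_fin_numE; last first.
  by apply: esumT_ge0 => i; rewrite lee_fin.
apply: le_lt_trans sf; apply: esumT_le => i; rewrite lee_fin; exact: ler_norm.
Qed.

Lemma nsum_ge0 I (f : I -> R) : (forall i, 0 <= f i) -> 0 <= nsum f.
Proof. by move=> f0; apply/fine_ge0/esumT_ge0 => i; rewrite lee_fin. Qed.

Lemma nsum_le I (f g : I -> R) : (forall i, 0 <= f i <= g i) ->
  abs_summable g -> nsum f <= nsum g.
Proof.
move=> fg sg; have f0 i : 0 <= f i by case/andP: (fg i).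
have g0 i : 0 <= g i by case/andP: (fg i) => /le_trans; apply.
have sf : abs_summable f.
  by apply: summable_le sg => i; rewrite ger0_norm //; case/andP: (fg i).
rewrite -lee_fin -!nsumE //; apply: esumT_le => i; rewrite lee_fin.
by case/andP: (fg i).
Qed.

Lemma abs_summableD I (f g : I -> R) :
  abs_summable f -> abs_summable g -> abs_summable (fun i => f i + g i).
Proof.
move=> sf sg; apply: (@le_lt_trans _ _ (\esumT_i (`|f i|%:E + `|g i|%:E))%E).
  by apply: esumT_le => i; rewrite -EFinD lee_fin ler_normD.
by rewrite esumTD ?lte_add_pinfty.
Qed.

Lemma abs_summableZ I (c : R) (f : I -> R) :
  abs_summable f -> abs_summable (fun i => c * f i).
Proof.
move=> sf; have nf i : 0 <= `|f i| by [].
rewrite /abs_summable (eq_esumT (b := fun i => `|c|%:E * `|f i|%:E)%E).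
  by rewrite esumTZ // (nsumE nf) ?summable_abs // -EFinM ltry.
by move=> i; rewrite normrM.
Qed.

Lemma abs_summableN I (f : I -> R) : abs_summable f -> abs_summable (fun i => - f i).
Proof. by apply: le_lt_trans; apply: esumT_le => i; rewrite normrN. Qed.

Lemma abs_summableB I (f g : I -> R) :
  abs_summable f -> abs_summable g -> abs_summable (fun i => f i - g i).
Proof. by move=> sf sg; apply: abs_summableD => //; exact: abs_summableN. Qed.

Lemma nsumD I (f g : I -> R) : (forall i, 0 <= f i) -> (forall i, 0 <= g i) ->
  abs_summable f -> abs_summable g ->
  nsum (fun i => f i + g i) = nsum f + nsum g.
Proof.
move=> f0 g0 sf sg; apply: EFin_inj; rewrite EFinD -!nsumE //.
- by rewrite -esumTD.
- by move=> i; rewrite addr_ge0.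
- exact: abs_summableD.
Qed.

Lemma nsumZ I (c : R) (f : I -> R) : 0 <= c -> (forall i, 0 <= f i) ->
  abs_summable f -> nsum (fun i => c * f i) = c * nsum f.
Proof.
move=> c0 f0 sf; apply: EFin_inj; rewrite EFinM -!nsumE //.
- by rewrite -esumTZ.
- by move=> i; rewrite mulr_ge0.
- exact: abs_summableZ.
Qed.

(** A sum over an arbitrary index type, independent of any enumeration; it is
    meaningful for absolutely summable families. *)
Definition rsum I (f : I -> R) : R :=
  nsum (fun i => Num.max (f i) 0) - nsum (fun i => Num.max (- f i) 0).

Lemma eq_rsum I (f g : I -> R) : f =1 g -> rsum f = rsum g.
Proof. by move=> fg; congr rsum; exact/funext. Qed.

(** Any two ways of writing a family as a difference of nonnegative summable
    families agree, because the cross sums do; linearity and the summation over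
    pairs reduce to the nonnegative case through it. *)
Lemma rsum_sub I (a b : I -> R) :
  (forall i, 0 <= a i) -> (forall i, 0 <= b i) ->
  abs_summable a -> abs_summable b ->
  rsum (fun i => a i - b i) = nsum a - nsum b.
Proof.
move=> a0 b0 sa sb; rewrite /rsum; set p := fun i => _; set m := fun i => _.
have p0 i : 0 <= p i by rewrite /p le_max lexx orbT.
have m0 i : 0 <= m i by rewrite /m le_max lexx orbT.
have sp : abs_summable p.
  apply: summable_le sa => i; rewrite ger0_norm // /p ge_max a0 andbT.
  by rewrite gerBl.
have sm : abs_summable m.
  apply: summable_le sb => i; rewrite ger0_norm // /m ge_max b0 andbT opprB.
  by rewrite gerBl.
apply/eqP; rewrite subr_eq addrAC eq_sym subr_eq -!nsumD //.
apply/eqP; congr nsum; apply/funext => i; rewrite /p /m.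
by have [h|h] := leP (a i - b i) 0; have [h'|h'] := leP (- (a i - b i)) 0; lra.
Qed.

Lemma summable_pos I (f : I -> R) :
  abs_summable f -> abs_summable (fun i => Num.max (f i) 0).
Proof.
move=> sf; apply: summable_le (summable_abs sf) => i.
by rewrite ger0_norm ?le_max ?lexx ?orbT // ge_max ler_norm normr_ge0.
Qed.

Lemma pos_part_sub (x : R) : x = Num.max x 0 - Num.max (- x) 0.
Proof. by have [h|h] := leP x 0; have [h'|h'] := leP (- x) 0; lra. Qed.

Lemma pos_ge0 (x : R) : 0 <= Num.max x 0.
Proof. by rewrite le_max lexx orbT. Qed.

Hint Resolve pos_ge0 : core.

Lemma rsum_nonneg I (f : I -> R) : (forall i, 0 <= f i) -> rsum f = nsum f.
Proof.
move=> f0; rewrite /rsum [X in _ - X](_ : _ = 0) ?subr0.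
  by congr nsum; apply/funext => i; apply/max_idPl.
rewrite /nsum (eq_esumT (b := fun=> 0)) ?esum1 // => i.
by congr EFin; apply/max_idPr; rewrite oppr_le0.
Qed.

Lemma rsumD I (f g : I -> R) : abs_summable f -> abs_summable g ->
  rsum (fun i => f i + g i) = rsum f + rsum g.
Proof.
move=> sf sg; have sf' := abs_summableN sf; have sg' := abs_summableN sg.
have -> : (fun i => f i + g i) = (fun i => (Num.max (f i) 0 + Num.max (g i) 0) -
    (Num.max (- f i) 0 + Num.max (- g i) 0)).
  by apply/funext => i; rewrite {1}(pos_part_sub (f i)) {1}(pos_part_sub (g i)); ring.
rewrite rsum_sub; first last.
- by apply: abs_summableD; exact: summable_pos.
- by apply: abs_summableD; exact: summable_pos.
- by move=> i; rewrite addr_ge0.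
- by move=> i; rewrite addr_ge0.
by rewrite !nsumD //; [rewrite /rsum; ring|exact: summable_pos..].
Qed.

Lemma rsumN I (f : I -> R) : rsum (fun i => - f i) = - rsum f.
Proof.
rewrite /rsum opprB; congr (_ - nsum _).
by apply/funext => i; rewrite opprK.
Qed.

Lemma rsumB I (f g : I -> R) : abs_summable f -> abs_summable g ->
  rsum (fun i => f i - g i) = rsum f - rsum g.
Proof. by move=> sf sg; rewrite rsumD ?rsumN //; exact: abs_summableN. Qed.

Lemma rsumZ I (c : R) (f : I -> R) : abs_summable f ->
  rsum (fun i => c * f i) = c * rsum f.
Proof.
wlog c0 : c / 0 <= c => [H sf|sf].
  have [/H->//|/ltW c0] := leP 0 c.
  rewrite -[c]opprK mulNr -H ?oppr_ge0 // -rsumN; apply: eq_rsum => i.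
  by rewrite mulNr.
have -> : (fun i => c * f i) = (fun i => c * Num.max (f i) 0 - c * Num.max (- f i) 0).
  by apply/funext => i; rewrite -mulrBr -pos_part_sub.
rewrite rsum_sub; first last.
- by apply/abs_summableZ/summable_pos/abs_summableN.
- exact/abs_summableZ/summable_pos.
- by move=> i; rewrite mulr_ge0.
- by move=> i; rewrite mulr_ge0.
by rewrite !nsumZ // /rsum ?mulrBr //; apply: summable_pos => //; exact: abs_summableN.
Qed.

Lemma rsum_norm I (f : I -> R) : abs_summable f ->
  `|rsum f| <= nsum (fun i => `|f i|).
Proof.
move=> sf; rewrite /rsum.
have -> : nsum (fun i => `|f i|) =
    nsum (fun i => Num.max (f i) 0) + nsum (fun i => Num.max (- f i) 0).
  rewrite -nsumD //; [|exact: summable_pos|exact/summable_pos/abs_summableN].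
  by congr nsum; apply/funext => i; case: ger0P => h;
    have [h1|h1] := leP (f i) 0; have [h2|h2] := leP (- f i) 0; lra.
apply: le_trans (ler_normB _ _) _.
by rewrite !ger0_norm // nsum_ge0.
Qed.

Lemma rsum_le I (f M : I -> R) : (forall i, `|f i| <= M i) -> abs_summable M ->
  `|rsum f| <= nsum M.
Proof.
move=> fM sM; apply: le_trans (rsum_norm (summable_le fM sM)) _.
by apply: nsum_le => // i; rewrite normr_ge0 fM.
Qed.

Lemma rsum_reindex I J (e : I -> J) (f : J -> R) : bijective e ->
  rsum f = rsum (fun i => f (e i)).
Proof. by move=> be; rewrite /rsum /nsum !(esumT_reindex _ be). Qed.

Lemma summable_pair I J (f : I * J -> R) : abs_summable f ->
  (forall i, abs_summable (fun j => f (i, j))) /\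
  abs_summable (fun i => nsum (fun j => `|f (i, j)|)).
Proof.
rewrite /abs_summable esumT_pair // => sf.
have sfi i : abs_summable (fun j => f (i, j)).
  apply: le_lt_trans sf.
  apply: (esumT_term (a := fun i => \esumT_j (`|f (i, j)|)%:E)) => {}i.
  exact: esumT_ge0.
split=> //; apply: le_lt_trans sf; apply: esumT_le => i.
rewrite ger0_norm ?nsum_ge0 //; rewrite nsumE //.
exact: summable_abs.
Qed.

Lemma nsum_pair I J (f : I * J -> R) : (forall k, 0 <= f k) -> abs_summable f ->
  nsum f = nsum (fun i => nsum (fun j => f (i, j))).
Proof.
move=> f0 sf; have [s1 s2] := summable_pair sf.
rewrite {1}/nsum esumT_pair; last by move=> k; rewrite lee_fin.
by congr fine; apply: eq_esumT => i; rewrite nsumE.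
Qed.

Lemma rsum_pair I J (f : I * J -> R) : abs_summable f ->
  rsum f = rsum (fun i => rsum (fun j => f (i, j))).
Proof.
move=> sf; have [s1 s2] := summable_pair sf; have sf' := abs_summableN sf.
transitivity (rsum (fun i => nsum (fun j => Num.max (f (i, j)) 0) -
  nsum (fun j => Num.max (- f (i, j)) 0))); last by [].
rewrite rsum_sub; last 4 first.
- by move=> i; apply: nsum_ge0.
- by move=> i; apply: nsum_ge0.
- apply: summable_le s2 => i; rewrite ger0_norm ?nsum_ge0 //.
  apply: nsum_le; last exact: summable_abs.
  by move=> j; rewrite pos_ge0 ge_max ler_norm normr_ge0.
- apply: summable_le s2 => i; rewrite ger0_norm ?nsum_ge0 //.
  apply: nsum_le; last exact: summable_abs.
  by move=> j; rewrite pos_ge0 ge_max normr_ge0 -normrN ler_norm.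
by rewrite {1}/rsum !nsum_pair //; exact: summable_pos.
Qed.

Lemma summable_fset I (A : {fset I}) (f : I -> R) :
  abs_summable (fun i => if i \in A then f i else 0) /\
  rsum (fun i => if i \in A then f i else 0) = \sum_(i <- A) f i.
Proof.
have key (g : I -> R) : (forall i, 0 <= g i) ->
    \esumT_i (if i \in A then g i else 0)%:E = (\sum_(i <- A) g i)%:E.
  move=> g0; transitivity (\esum_(i in [set` A]) (g i)%:E).
    rewrite [RHS]esum_mkcond; apply: eq_esumT => i.
    by rewrite mem_setE; case: ifP.
  rewrite esum_fset //; last by move=> i _; rewrite lee_fin.
  by rewrite fsbig_finite //= set_fsetK sumEFin.
have s1 (g : I -> R) : (forall i, 0 <= g i) ->
    abs_summable (fun i => if i \in A then g i else 0).
  move=> g0; apply: summable_fin; first by move=> i; case: ifP.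
  by rewrite key // ltry.
split.
  apply: summable_le (s1 (fun i => `|f i|) _) => // i.
  by case: ifP => //; rewrite normr0.
have -> : (fun i => if i \in A then f i else 0) =
    (fun i => (if i \in A then Num.max (f i) 0 else 0) -
      (if i \in A then Num.max (- f i) 0 else 0)).
  by apply/funext => i; case: ifP => _; rewrite ?subr0 // -pos_part_sub.
rewrite rsum_sub; first last; rewrite ?s1 //; try by move=> i; case: ifP.
rewrite /nsum !key //= -sumrB; apply: eq_bigr => i _.
by rewrite -pos_part_sub.
Qed.

Lemma rsum_off I (A : {fset I}) (f : I -> R) : abs_summable f ->
  abs_summable (fun i => if i \in A then 0 else f i) /\
  rsum (fun i => if i \in A then 0 else f i) = rsum f - \sum_(i <- A) f i.
Proof.
move=> sf; have [s1 e1] := summable_fset A f.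
have -> : (fun i => if i \in A then 0 else f i) =
    (fun i => f i - (if i \in A then f i else 0)).
  by apply/funext => i; case: ifP => _; rewrite ?subrr ?subr0.
by split; [exact: abs_summableB|rewrite rsumB // e1].
Qed.

(** Outside a finite set the sum is dominated by the tail of the majorant,
    uniformly in the family. *)
Lemma rsum_partial_error I (A B : {fset I}) (f M : I -> R) : (A `<=` B)%fset ->
  (forall i, `|f i| <= M i) -> abs_summable M ->
  `|rsum f - \sum_(i <- B) f i| <= nsum M - \sum_(i <- A) M i.
Proof.
move=> /fsubsetP AB fM sM; have sf := summable_le fM sM.
have M0 i : 0 <= M i by apply: le_trans (fM i).
have [_ <-] := rsum_off B sf; have [s' e'] := rsum_off A sM.
rewrite -[in leRHS]rsum_nonneg // -e' [leRHS]rsum_nonneg; last by move=> i; case: ifP.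
apply: rsum_le => // i.
case: ifPn => iB; first by rewrite normr0; case: ifP.
by rewrite ifN //; apply: contra iB; exact: AB.
Qed.

Lemma nsum_approx I (M : I -> R) (e : R) : (forall i, 0 <= M i) ->
  abs_summable M -> 0 < e ->
  exists A : {fset I}, nsum M - \sum_(i <- A) M i < e.
Proof.
move=> M0 sM e0.
have fM : \esumT_i (M i)%:E \is a fin_num by rewrite nsumE.
have [_ [X [finX _] <-]] := ub_ereal_sup_adherent e0 fM.
rewrite -/(esum setT _) nsumE // fsbig_finite //= sumEFin -EFinB lte_fin => h.
by exists (fset_set X); lra.
Qed.

Lemma cvg_sum_seq (T : Type) (F : set_system T) (FF : Filter F) I (s : seq I)
    (g : T -> I -> R) (l : I -> R) : (forall i, g y i @[y --> F] --> l i) ->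
  \sum_(i <- s) g y i @[y --> F] --> \sum_(i <- s) l i.
Proof.
move=> gl; elim: s => [|i s IH].
  by under eq_fun do rewrite big_nil; rewrite big_nil; exact: cvg_cst.
by under eq_fun do rewrite big_cons; rewrite big_cons; exact: cvgD.
Qed.

(** Dominated convergence: a finite set carries all but a small part of the
    majorant, and on that set the convergence is that of a finite sum. *)
Lemma rsum_cvg (T : Type) (F : set_system T) (FF : ProperFilter F) I
    (g : T -> I -> R) (l M : I -> R) : abs_summable M ->
  (\forall y \near F, forall i, `|g y i| <= M i) ->
  (forall i, g y i @[y --> F] --> l i) -> rsum (g y) @[y --> F] --> rsum l.
Proof.
move=> sM gM gl.
have lM i : `|l i| <= M i.
  have hl : `|g y i| @[y --> F] --> `|l i| by apply: cvg_norm; exact: gl.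
  rewrite -(cvg_lim (@norm_hausdorff _ _) hl); apply: limr_le.
    by apply/cvg_ex; exists `|l i|.
  by apply: filterS gM => y; apply.
have M0 i : 0 <= M i by apply: le_trans (lM i).
have sl := summable_le lM sM.
apply/cvgrPdist_lt => e e0.
have e3 : 0 < e / 3 by rewrite divr_gt0.
have [A hA] := nsum_approx M0 sM e3.
have hS : \sum_(i <- A) g y i @[y --> F] --> \sum_(i <- A) l i.
  exact: cvg_sum_seq.
move/cvgrPdist_lt: hS => /(_ _ e3) hS.
near=> y.
have gyM : forall i, `|g y i| <= M i by near: y.
have h1 := rsum_partial_error (fsubset_refl A) lM sM.
have h2 := rsum_partial_error (fsubset_refl A) gyM sM.
have h3 : `|\sum_(i <- A) l i - \sum_(i <- A) g y i| < e / 3 by near: y.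
move: h1 h2 h3; rewrite !ler_norml !ltr_norml.
move=> /andP[? ?] /andP[? ?] /andP[? ?]; apply/andP; split; lra.
Unshelve. all: by end_near. Qed.

End RealSums.

Section InjReindex.
Variable R : realType.
Implicit Types (I J : choiceType).

(** Terms off the image of an injection may be dropped when they vanish. It
    serves both the shift of the time index in a time derivative and the
    regrouping of a product of series. *)
Lemma esumT_inj I J (e : I -> J) (a : J -> \bar R) : injective e ->
  (forall j, (forall i, j <> e i) -> a j = 0%E) ->
  \esumT_j a j = \esumT_i a (e i).
Proof.
move=> ie a0; rewrite -(@esum_image _ _ _ setT e a); last by move=> ? ? _ _; exact: ie.
rewrite [RHS]esum_mkcond; apply: eq_esumT => j.
case: ifPn => //; rewrite notin_setE /= => h; rewrite a0 // => i ji.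
by apply: h; exists i.
Qed.

Lemma rsum_inj I J (e : I -> J) (f : J -> R) : injective e ->
  (forall j, (forall i, j <> e i) -> f j = 0) ->
  rsum f = rsum (fun i => f (e i)).
Proof.
move=> ie f0; rewrite /rsum /nsum; congr (fine _ - fine _);
  by apply: esumT_inj => // j /f0 ->; rewrite ?oppr0 maxxx.
Qed.

Lemma summable_inj I J (e : I -> J) (f : J -> R) : injective e ->
  abs_summable f -> abs_summable (fun i => f (e i)).
Proof.
move=> ie; rewrite /abs_summable.
rewrite -(@esum_image _ _ _ setT e (fun j => (`|f j|)%:E));
  last by move=> ? ? _ _; exact: ie.
apply: le_lt_trans; rewrite esum_mkcond; apply: esumT_le => j.
by case: ifP.
Qed.

End InjReindex.

Section TermwiseDerivative.
Variable R : realType.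

(** The mean value theorem bounds the difference quotients of the terms by the
    bound on their derivatives, and dominated convergence applies. *)
Lemma rsum_is_derive (I : choiceType) (f df : I -> R -> R) (M : I -> R) (x r : R) :
  0 < r -> abs_summable M ->
  (forall i y, `|y - x| < r -> is_derive y 1 (f i) (df i y)) ->
  (forall i y, `|y - x| < r -> `|df i y| <= M i) ->
  abs_summable (f ^~ x) ->
  is_derive x 1 (fun y => rsum (f ^~ y)) (rsum (df ^~ x)).
Proof.
move=> r0 sM fd dM sf.
have M0 i : 0 <= M i by apply: le_trans (dM i x _); rewrite ?subrr ?normr0.
have lip i (y : R) : `|y - x| < r -> `|f i y - f i x| <= M i * `|y - x|.
  have aux (a b : R) : a <= b -> `|a - x| < r -> `|b - x| < r ->
      `|f i b - f i a| <= M i * `|b - a|.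
    move=> ab ar br.
    have inside (z : R) : a <= z <= b -> `|z - x| < r.
      move: ar br; rewrite !ltr_norml => /andP[? ?] /andP[? ?] /andP[? ?].
      by apply/andP; split; lra.
    have fab : {within `[a, b], continuous (f i)}.
      apply: derivable_within_continuous => z; rewrite in_itv /= => zab.
      by have [] := fd i z (inside z zab).
    have dab z : z \in `]a, b[ -> is_derive z 1 (f i) (df i z).
      by rewrite in_itv /= => /andP[az zb]; apply/fd/inside; rewrite !ltW.
    have [c] := MVT_segment ab dab fab.
    rewrite in_itv /= => cab ->.
    by rewrite normrM ler_wpM2r // dM // inside.
  move=> yr; have [yx|xy] := leP y x.
    by rewrite distrC (distrC y) aux // ?subrr ?normr0.
  by rewrite aux // ?subrr ?normr0 // ltW.
have sfy (y : R) : `|y - x| < r -> abs_summable (f ^~ y).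
  move=> yr; have -> : f ^~ y = (fun i => (f i y - f i x) + f i x).
    by apply/funext => i; rewrite subrK.
  apply: abs_summableD => //.
  apply: summable_le (abs_summableZ `|y - x| sM) => i.
  by rewrite mulrC lip.
have near0 : \forall h \near (0 : R)^', `|h| < r by exact: dnbhs0_lt.
have key : h^-1 *: (rsum (f ^~ (h + x)) - rsum (f ^~ x)) @[h --> (0 : R)^']
    --> rsum (df ^~ x).
  have : rsum (fun i => h^-1 * (f i (h + x) - f i x)) @[h --> (0 : R)^']
    --> rsum (df ^~ x).
    apply: (@rsum_cvg _ _ _ _ _ (fun h i => h^-1 * (f i (h + x) - f i x)) _ M) => //.
      near=> h => i; rewrite normrM normfV mulrC ler_pdivrMr; last first.
        by rewrite normr_gt0; near: h; exact: nbhs_dnbhs_neq.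
      have := lip i (h + x); rewrite addrK; apply.
      by near: h.
    move=> i; have := fd i x; rewrite subrr normr0 => /(_ r0) [dx <-].
    by move: dx; rewrite /derive /derivable /shift /=;
     under eq_fun do rewrite scaler1.
  apply: cvg_trans; apply: near_eq_cvg; near=> h.
  rewrite rsumZ; last first.
    by apply: abs_summableB => //; apply: sfy; rewrite addrK; near: h.
  by rewrite rsumB //; apply: sfy; rewrite addrK; near: h.
apply: DeriveDef.
  rewrite /derivable /shift /=; under eq_fun do rewrite scaler1.
  by apply/cvg_ex; exists (rsum (df ^~ x)).
rewrite /derive /shift /=; under eq_fun do rewrite scaler1.
exact: cvg_lim.
Unshelve. all: by end_near. Qed.

End TermwiseDerivative.

(** * Sums of complex families *)

Section Modulus.
Variable R : realType.
Implicit Types z w : R[i].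

Lemma normc_zero : normc (0 : R[i]) = 0.
Proof. exact: Normc.normc0. Qed.

Lemma normc_ge0 z : 0 <= normc z.
Proof. by case: z => a b; exact: sqrtr_ge0. Qed.

Lemma cReM z w : Re (z * w) = Re z * Re w - Im z * Im w.
Proof. by case: z; case: w. Qed.

Lemma cImM z w : Im (z * w) = Re z * Im w + Im z * Re w.
Proof. by case: z; case: w. Qed.

Lemma cReD z w : Re (z + w) = Re z + Re w.
Proof. by case: z; case: w. Qed.

Lemma cImD z w : Im (z + w) = Im z + Im w.
Proof. by case: z; case: w. Qed.

Lemma cReN z : Re (- z) = - Re z.
Proof. by case: z. Qed.

Lemma cImN z : Im (- z) = - Im z.
Proof. by case: z. Qed.

Lemma eq_ReIm z w : Re z = Re w -> Im z = Im w -> z = w.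
Proof. by case: z; case: w => a b c d /= -> ->. Qed.

Lemma normc_Re z : `|Re z| <= normc z.
Proof.
case: z => a b /=; rewrite -sqrtr_sqr ler_sqrt ?addr_ge0 ?sqr_ge0 //.
by rewrite lerDl sqr_ge0.
Qed.

Lemma normc_Im z : `|Im z| <= normc z.
Proof.
case: z => a b /=; rewrite -sqrtr_sqr ler_sqrt ?addr_ge0 ?sqr_ge0 //.
by rewrite lerDr sqr_ge0.
Qed.

Lemma normc_real (a : R) : normc a%:C = `|a|.
Proof. by rewrite /= expr0n /= addr0 sqrtr_sqr. Qed.

Lemma normcD z w : normc (z + w) <= normc z + normc w.
Proof. exact: le_normcD. Qed.

Lemma normcM z w : normc (z * w) = normc z * normc w.
Proof. exact: Normc.normcM. Qed.

Lemma normcN z : normc (- z) = normc z.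
Proof. exact: normcN. Qed.

Lemma normc_le_ReIm z : normc z <= `|Re z| + `|Im z|.
Proof.
rewrite {1}(complexE z); apply: le_trans (normcD _ _) _.
rewrite normcM !normc_real lerD2l.
by rewrite /= expr0n /= add0r expr1n sqrtr1 mul1r.
Qed.

Lemma normc_cis (a : R) : normc (cis a) = 1.
Proof. by rewrite /= cos2Dsin2 sqrtr1. Qed.

Lemma cisD (a b : R) : cis (a + b) = cis a * cis b.
Proof. by apply: eq_ReIm; rewrite ?cReM ?cImM /= ?cosD ?sinD; ring. Qed.

Lemma cisN (a : R) : cis (- a) = conjc (cis a).
Proof. by rewrite /cis cosN sinN. Qed.

Lemma cis0 : cis (0 : R) = 1.
Proof. by rewrite /cis cos0 sin0. Qed.

Lemma normc_conj z : normc (conjc z) = normc z.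
Proof. by case: z => a b /=; rewrite sqrrN. Qed.

Lemma normc_norm (z : R[i]^o) : `|z| = (normc z)%:C.
Proof. by rewrite normc_def; case: z. Qed.

Lemma normc_sum I (r : seq I) (P : pred I) (F : I -> R[i]) :
  normc (\sum_(i <- r | P i) F i) <= \sum_(i <- r | P i) normc (F i).
Proof.
elim/big_rec2: _ => [|i y z _ h]; first by rewrite normc_zero.
by apply: le_trans (normcD _ _) _; rewrite lerD2l.
Qed.

Lemma Re_sum I (r : seq I) (P : pred I) (F : I -> R[i]) :
  Re (\sum_(i <- r | P i) F i) = \sum_(i <- r | P i) Re (F i).
Proof. by elim/big_rec2: _ => // i y z _ <-; rewrite cReD. Qed.

Lemma Im_sum I (r : seq I) (P : pred I) (F : I -> R[i]) :
  Im (\sum_(i <- r | P i) F i) = \sum_(i <- r | P i) Im (F i).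
Proof. by elim/big_rec2: _ => // i y z _ <-; rewrite cImD. Qed.

End Modulus.

Section ComplexSums.
Variable R : realType.
Implicit Types (I J : choiceType).

Definition csummable I (c : I -> R[i]) := abs_summable (fun i => normc (c i)).

Definition csum I (c : I -> R[i]) : R[i] :=
  rsum (fun i => Re (c i)) +i* rsum (fun i => Im (c i)).

Lemma eq_csum I (a b : I -> R[i]) : a =1 b -> csum a = csum b.
Proof. by move=> ab; congr csum; exact/funext. Qed.

Lemma csummableE I (c : I -> R[i]) :
  csummable c = (\esumT_i (normc (c i))%:E < +oo)%E :> Prop.
Proof.
rewrite /csummable /abs_summable; congr (is_true (_ < _)%E).
by apply: eq_esumT => i; rewrite ger0_norm ?normc_ge0.
Qed.

Lemma csummable_le I (a : I -> R[i]) (M : I -> R) :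
  (forall i, normc (a i) <= M i) -> abs_summable M -> csummable a.
Proof. by move=> aM; apply: summable_le => i; rewrite ger0_norm ?normc_ge0. Qed.

Lemma csummable_Re I (c : I -> R[i]) : csummable c -> abs_summable (fun i => Re (c i)).
Proof. by apply: summable_le => i; exact: normc_Re. Qed.

Lemma csummable_Im I (c : I -> R[i]) : csummable c -> abs_summable (fun i => Im (c i)).
Proof. by apply: summable_le => i; exact: normc_Im. Qed.

Hint Resolve csummable_Re csummable_Im : core.

Lemma csummableD I (a b : I -> R[i]) : csummable a -> csummable b ->
  csummable (fun i => a i + b i).
Proof.
move=> sa sb; apply: csummable_le (abs_summableD sa sb) => i; exact: normcD.
Qed.

Lemma csummableZ I (z : R[i]) (a : I -> R[i]) : csummable a ->
  csummable (fun i => z * a i).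
Proof.
move=> sa; apply: csummable_le (abs_summableZ (normc z) sa) => i.
by rewrite normcM.
Qed.

Lemma csumD I (a b : I -> R[i]) : csummable a -> csummable b ->
  csum (fun i => a i + b i) = csum a + csum b.
Proof.
move=> sa sb; apply: eq_ReIm; rewrite ?cReD ?cImD /= -rsumD; auto;
  by apply: eq_rsum => i; rewrite ?cReD ?cImD.
Qed.

Lemma csumZ I (z : R[i]) (a : I -> R[i]) : csummable a ->
  csum (fun i => z * a i) = z * csum a.
Proof.
move=> sa; have sr := csummable_Re sa; have si := csummable_Im sa.
apply: eq_ReIm; rewrite ?cReM ?cImM /= -!rsumZ //.
  by rewrite -rsumB; [apply: eq_rsum => i; rewrite cReM|exact: abs_summableZ..].
by rewrite -rsumD; [apply: eq_rsum => i; rewrite cImM|exact: abs_summableZ..].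
Qed.

Lemma csum_conj I (a : I -> R[i]) : csum (fun i => conjc (a i)) = conjc (csum a).
Proof.
apply: eq_ReIm => /=; last rewrite -rsumN.
  by apply: eq_rsum => i; case: (a i).
by apply: eq_rsum => i; case: (a i).
Qed.

Lemma csum0 I : csum (fun i : I => 0) = 0 :> R[i].
Proof.
rewrite -[RHS](mul0r (csum (fun i : I => 0 : R[i]))) -csumZ.
  by apply: eq_csum => i; rewrite mul0r.
by rewrite csummableE esum1 ?ltry // => i _; rewrite normc_zero.
Qed.

Lemma csum_inj I J (e : I -> J) (c : J -> R[i]) : injective e ->
  (forall j, (forall i, j <> e i) -> c j = 0) ->
  csum c = csum (fun i => c (e i)).
Proof.
move=> ie c0; rewrite /csum; congr Complex;
  by apply: rsum_inj => // j /c0 ->.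
Qed.

Lemma csum_reindex I J (e : I -> J) (c : J -> R[i]) : bijective e ->
  csum c = csum (fun i => c (e i)).
Proof.
by move=> be; rewrite /csum; congr Complex; apply: rsum_reindex.
Qed.

Lemma csummable_inj I J (e : I -> J) (c : J -> R[i]) : injective e ->
  csummable c -> csummable (fun i => c (e i)).
Proof. by move=> ie; apply: (summable_inj ie). Qed.

(** The factor 2 comes from estimating the real and imaginary parts
    separately. Stated with extended reals, the bound also covers families that
    are not summable; in the estimates on the recursion it is thus available
    before summability is known. *)
Lemma csum_norm I (c : I -> R[i]) :
  ((normc (csum c))%:E <= 2%:E * \esumT_i (normc (c i))%:E)%E.
Proof.
have [sc|] := boolP (\esumT_i (normc (c i))%:E < +oo)%E; last first.
  rewrite ltey negbK => /eqP ->; rewrite mulry gtr0_sg // mul1e; exact: leey.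
have sc' : csummable c by rewrite csummableE.
rewrite nsumE //; last by move=> i; exact: normc_ge0.
rewrite -EFinM lee_fin; apply: le_trans (normc_le_ReIm _) _ => /=.
rewrite mulr_natl mulr2n lerD // rsum_le // => i.
  exact: normc_Re.
exact: normc_Im.
Qed.

Lemma csummable_pair I J (c : I * J -> R[i]) : csummable c ->
  (forall i, csummable (fun j => c (i, j))) /\
  csummable (fun i => csum (fun j => c (i, j))).
Proof.
move=> sc; have [s1 s2] := summable_pair sc; split => //.
apply: csummable_le (abs_summableZ 2 s2) => i.
rewrite -lee_fin; apply: le_trans (csum_norm _) _.
rewrite EFinM -nsumE //; last exact: summable_abs.
by rewrite lee_pmul2l //; apply: esumT_le => j; rewrite lee_fin ler_norm.
Qed.

Lemma csum_pair I J (c : I * J -> R[i]) : csummable c ->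
  csum c = csum (fun i => csum (fun j => c (i, j))).
Proof.
by move=> sc; rewrite /csum; congr Complex; rewrite rsum_pair; auto.
Qed.

Lemma csum_exchange I J (c : I -> J -> R[i]) :
  csummable (fun k : I * J => c k.1 k.2) ->
  csum (fun i => csum (fun j => c i j)) = csum (fun j => csum (fun i => c i j)).
Proof.
move=> sc; rewrite -(csum_pair sc).
have be : bijective (fun k : J * I => (k.2, k.1)).
  by exists (fun k : I * J => (k.2, k.1)) => -[].
rewrite (csum_reindex _ be) csum_pair //=.
exact: (csummable_inj (bij_inj be) sc).
Qed.

Lemma esumT_prod I J (x : I -> R) (y : J -> R) (A B : R) :
  (forall i, 0 <= x i) -> (forall j, 0 <= y j) ->
  (\esumT_i (x i)%:E <= A%:E)%E -> (\esumT_j (y j)%:E <= B%:E)%E ->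
  (\esumT_k (x k.1 * y k.2)%:E <= (A * B)%:E)%E.
Proof.
move=> x0 y0 xA yB.
have B0 : (0 <= B%:E)%E.
  by apply: le_trans yB; apply: esumT_ge0 => j; rewrite lee_fin.
rewrite esumT_pair; last by move=> k; rewrite lee_fin mulr_ge0.
have -> : \esumT_i \esumT_j (x (i, j).1 * y (i, j).2)%:E =
    \esumT_i ((x i)%:E * \esumT_j (y j)%:E)%E.
  apply: eq_esumT => i; rewrite -esumTZ // => j; by rewrite lee_fin.
apply: (@le_trans _ _ (\esumT_i (B%:E * (x i)%:E))%E).
  by apply: esumT_le => i; rewrite muleC lee_wpmul2r // lee_fin.
rewrite esumTZ //.
by rewrite mulrC EFinM; apply: lee_wpmul2l.
Qed.

Lemma csummable_prod I J (a : I -> R[i]) (b : J -> R[i]) :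
  csummable a -> csummable b -> csummable (fun k : I * J => a k.1 * b k.2).
Proof.
move=> sa sb; rewrite csummableE.
apply: (@le_lt_trans _ _ (nsum (fun i => normc (a i)) * nsum (fun j => normc (b j)))%:E);
  last by rewrite ltry.
under eq_esumT do rewrite normcM.
apply: (esumT_prod (x := fun i => normc (a i)) (y := fun j => normc (b j)));
  try by move=> i; exact: normc_ge0.
  by rewrite nsumE // => i; exact: normc_ge0.
by rewrite nsumE // => i; exact: normc_ge0.
Qed.

Lemma csum_prod I J (a : I -> R[i]) (b : J -> R[i]) :
  csummable a -> csummable b ->
  csum a * csum b = csum (fun k : I * J => a k.1 * b k.2).
Proof.
move=> sa sb; rewrite csum_pair /=; last exact: csummable_prod.
rewrite mulrC -csumZ //; apply: eq_csum => i.
by rewrite csumZ // mulrC.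
Qed.

Lemma csum_sum I (J : Type) (r : seq J) (c : J -> I -> R[i]) :
  (forall j, csummable (c j)) ->
  csummable (fun i => \sum_(j <- r) c j i) /\
  csum (fun i => \sum_(j <- r) c j i) = \sum_(j <- r) csum (c j).
Proof.
move=> sc; elim: r => [|j r [IH1 IH2]].
  split.
    rewrite csummableE esum1 ?ltry // => i _.
    by rewrite big_nil normc_zero.
  rewrite big_nil -[RHS](csum0 I); by apply: eq_csum => i; rewrite big_nil.
have -> : (fun i => \sum_(j0 <- j :: r) c j0 i) =
    (fun i => c j i + \sum_(j0 <- r) c j0 i).
  by apply/funext => i; rewrite big_cons.
by split; [exact: csummableD|rewrite big_cons -IH2 csumD].
Qed.

(** Real and imaginary parts are both within half of the tolerance once the
    finite set carries all but that much of the modulus. *)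
Lemma csum_totally I (c : I -> R[i]) : csummable c ->
  summability.partial_sum (c : I -> R[i]^o) @ summability.totally -->
    (csum c : R[i]^o).
Proof.
move=> sc; have FF := @summability.totally_filter I.
apply/cvgrPdist_lt => -[e e'] /=; rewrite ltcE /= => /andP[/eqP -> e0].
have e2 : 0 < e / 2 by rewrite divr_gt0.
have [A hA] := nsum_approx (fun i => normc_ge0 (c i)) sc e2.
exists A => // B AB /=; rewrite normc_norm ltcR.
rewrite /summability.partial_sum -(big_seq_fsetE _ _ predT c) /=.
apply: le_lt_trans (normc_le_ReIm _) _.
rewrite cReD cImD cReN cImN Re_sum Im_sum /=.
have h1 := rsum_partial_error AB (fun i => normc_Re (c i)) sc.
have h2 := rsum_partial_error AB (fun i => normc_Im (c i)) sc.
lra.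
Qed.

Lemma csum_unique I (c : I -> R[i]) (v : R[i]) : csummable c ->
  summability.partial_sum (c : I -> R[i]^o) @ summability.totally --> (v : R[i]^o) ->
  csum c = v.
Proof.
move=> sc cv; have := csum_totally sc.
have FF := @summability.totally_filter I.
by move=> h; apply: (cvg_unique (@norm_hausdorff _ R[i]^o) h cv).
Qed.

End ComplexSums.

(** * Fourier coefficients of trigonometric series *)

Section SegmentIntegral.
Variable R : realType.
Local Notation mu := (@lebesgue_measure R).

Lemma continuous_integrable (a b : R) (f : R -> R) : continuous f ->
  mu.-integrable `[a, b] (EFin \o f).
Proof.
move=> cf; apply: continuous_compact_integrable; first exact: segment_compact.
exact: continuous_subspaceT.
Qed.

Lemma le_normr_segment_integral (a b B : R) (f : R -> R) : a <= b ->
  continuous f -> (forall s, `|f s| <= B) ->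
  `|\int[mu]_(s in `[a, b]) f s| <= (b - a) * B.
Proof.
move=> ab cf fB; apply: le_trans (le_normr_Rintegral _ _) _ => //.
  exact: continuous_integrable.
apply: le_trans (le_Rintegral _ _ _ (f2 := fun=> B) _) _ => //.
- by apply: continuous_integrable => s; apply: cvg_norm; exact: cf.
- by apply: continuous_integrable; exact: cst_continuous.
rewrite Rintegral_cst //= lebesgue_measure_itv /= lte_fin mulrC.
case: ltP => h //=.
by rewrite (_ : b = a) ?subrr //; apply/eqP; rewrite eq_le h ab.
Qed.

Lemma segment_integral_sum I (r : seq I) (a b : R) (g : I -> R -> R) :
  (forall i, continuous (g i)) ->
  continuous (fun s => \sum_(i <- r) g i s) /\
  \int[mu]_(s in `[a, b]) (\sum_(i <- r) g i s) =
    \sum_(i <- r) \int[mu]_(s in `[a, b]) g i s.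
Proof.
move=> cg; elim: r => [|i r [IHc IH]].
  have -> : (fun s => \sum_(i <- [::]) g i s) = fun=> 0.
    by apply/funext => s; rewrite big_nil.
  by split; [exact: cst_continuous|rewrite big_nil Rintegral_cst // mul0r].
have -> : (fun s => \sum_(j <- i :: r) g j s) =
    (fun s => g i s + \sum_(j <- r) g j s).
  by apply/funext => s; rewrite big_cons.
split; first by move=> s; apply: cvgD; [exact: cg|exact: IHc].
by rewrite big_cons -IH RintegralD //; exact: continuous_integrable.
Qed.

(** A finite partial sum approximates the series uniformly, hence its integral,
    and the same majorant controls the series of the integrals. *)
Lemma segment_integral_rsum (I : choiceType) (a b : R) (g : I -> R -> R)
    (M : I -> R) : a <= b -> abs_summable M ->
  (forall i, continuous (g i)) -> (forall i s, `|g i s| <= M i) ->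
  \int[mu]_(s in `[a, b]) rsum (g ^~ s) =
    rsum (fun i => \int[mu]_(s in `[a, b]) g i s).
Proof.
move=> ab sM cg gM.
have M0 i : 0 <= M i by apply: le_trans (gM i 0).
have crg : continuous (fun s => rsum (g ^~ s)).
  move=> s; apply: (@rsum_cvg _ _ (nbhs s) _ _ (fun s i => g i s) (g ^~ s) M sM).
    by near=> y => i; exact: gM.
  by move=> i; exact: cg.
have intM i : `|\int[mu]_(s in `[a, b]) g i s| <= (b - a) * M i.
  exact: le_normr_segment_integral.
have sM' : abs_summable (fun i => (b - a) * M i) by exact: abs_summableZ.
apply/eqP; rewrite -subr_eq0 -normr_le0; apply/ler_addgt0Pl => e e0.
rewrite addr0.
have ab1 : 0 < b - a + 1 by rewrite ltr_wpDl // subr_ge0.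
have e3 : 0 < e / 2 / (b - a + 1) by rewrite !divr_gt0.
have [A hA] := nsum_approx M0 sM e3.
have h1 := rsum_partial_error (fsubset_refl A) intM sM'.
have [cS eS] := segment_integral_sum A a b cg.
have h2 : `|\int[mu]_(s in `[a, b]) rsum (g ^~ s) -
    \sum_(i <- A) \int[mu]_(s in `[a, b]) g i s| <=
    (b - a) * (nsum M - \sum_(i <- A) M i).
  rewrite -eS -RintegralB //; [|exact: continuous_integrable..].
  apply: le_normr_segment_integral => //.
    by move=> s; apply: cvgB; [exact: crg|exact: cS].
  move=> s; apply: rsum_partial_error (fsubset_refl A) _ sM => i; exact: gM.
rewrite nsumZ ?subr_ge0 // -mulr_sumr -mulrBr in h1.
have h3 : (b - a) * (nsum M - \sum_(i <- A) M i) <= e / 2.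
  have t0 : 0 <= nsum M - \sum_(i <- A) M i.
    exact: le_trans (normr_ge0 _)
      (rsum_partial_error (fsubset_refl A) (fun i => gM i 0) sM).
  apply: (@le_trans _ _ ((b - a + 1) * (e / 2 / (b - a + 1)))).
    by rewrite ler_pM // ?subr_ge0 // ?lerDl // ltW.
  by rewrite mulrC divfK // gt_eqF.
move: h1 h2 h3; rewrite !ler_norml => /andP[? ?] /andP[? ?] ?.
apply/andP; split; lra.
Unshelve. all: by end_near. Qed.

Lemma cis_intr2pi (m : int) : cis (m%:~R * (2 * pi)) = 1 :> R[i].
Proof.
have p n : cis (n%:R * (2 * pi)) = 1 :> R[i].
  elim: n => [|n IH]; first by rewrite mul0r cis0.
  rewrite -addn1 natrD mulrDl cisD IH mul1r mul1r mulr_natl.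
  by rewrite /cis cos2pi sin2pi.
case: m => n; first exact: p.
by rewrite NegzE mulrNz mulNr cisN p conjc1.
Qed.

(** For m <> 0 the integrand has a periodic primitive. *)
Lemma integral_trig_monomial (z : R[i]) (m : int) :
  \int[mu]_(s in `[0, 2 * pi]) Re (z * cis (m%:~R * s)) =
    if m == 0 then 2 * pi * Re z else 0.
Proof.
have pi2 : 0 < 2 * pi :> R by rewrite mulr_gt0 // pi_gt0.
case: eqVneq => [->|m0].
  under eq_Rintegral do rewrite mul0r cis0 mulr1.
  by rewrite Rintegral_cst //= lebesgue_measure_itv /= lte_fin pi2 /= subr0 mulrC.
have mR0 : m%:~R != 0 :> R by rewrite intr_eq0.
pose F (s : R) := m%:~R^-1 * Im (z * cis (m%:~R * s)).
have dF (s : R) : is_derive s 1 F (Re (z * cis (m%:~R * s))).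
  rewrite /F; have -> : (fun s : R => m%:~R^-1 * Im (z * cis (m%:~R * s))) =
    (fun s => m%:~R^-1 * (Re z * sin (m%:~R * s) + Im z * cos (m%:~R * s))).
    by apply/funext => t; rewrite cImM.
  apply: is_derive_eq; rewrite cReM /=.
  by rewrite /GRing.scale /= !mulr1; field.
have cF : continuous F.
  move=> s; apply/differentiable_continuous/derivable1_diffP.
  by have [] := dF s.
have cf : continuous (fun s : R => Re (z * cis (m%:~R * s))).
  have -> : (fun s : R => Re (z * cis (m%:~R * s))) =
      (fun s => Re z * cos (m%:~R * s) - Im z * sin (m%:~R * s)).
    by apply/funext => t; rewrite cReM.
  move=> s; apply/differentiable_continuous/derivable1_diffP.
  exact: ex_derive.
rewrite /Rintegral (@continuous_FTC2 _ _ F) //.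
- rewrite /F mulr0 cis0 cis_intr2pi /= subrr //.
- exact: continuous_subspaceT.
- split; first by move=> s _; have [] := dF s.
    by apply: cvg_at_right_filter; exact: cF.
  by apply: cvg_at_left_filter; exact: cF.
- by move=> s _; rewrite derive1E; have [] := dF s.
Qed.

End SegmentIntegral.

Section SingleTerm.
Variables (R : realType) (I : choiceType).

Lemma rsum_single (i0 : I) (f : I -> R) :
  (forall i, i != i0 -> f i = 0) -> rsum f = f i0.
Proof.
move=> f0; have [_] := summable_fset [fset i0]%fset f.
rewrite big_seq_fset1 => <-; apply: eq_rsum => i.
by rewrite inE; case: eqVneq => // /f0.
Qed.

Lemma csum_single (i0 : I) (c : I -> R[i]) :
  (forall i, i != i0 -> c i = 0) -> csum c = c i0.
Proof.
move=> c0; apply: eq_ReIm => /=; apply: (rsum_single (i0 := i0)) => i /c0 -> //.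
Qed.

End SingleTerm.

Section FourierCoefficients.
Variable R : realType.
Local Notation mu := (@lebesgue_measure R).

Definition trig_series d (c : 'rV[int]_d -> R[i]) (x : 'rV[R]_d) : R[i] :=
  csum (fun k => c k * cis (phase k x)).

Lemma csummable_phase (I : choiceType) (c : I -> R[i]) (a : I -> R) :
  csummable c -> csummable (fun k => c k * cis (a k)).
Proof.
move=> sc; apply: csummable_le sc => k.
by rewrite normcM normc_cis mulr1.
Qed.

Lemma phase_row_mx d (m : int) (k : 'rV[int]_d) (s : R) (y : 'rV[R]_d) :
  phase (row_mx (m%:M : 'rV_1) k) (row_mx (s%:M : 'rV_1) y) =
  m%:~R * s + phase k y.
Proof.
rewrite /phase big_split_ord /= big_ord1 !row_mxEl !mxE eqxx !mulr1n.
by congr (_ + _); apply: eq_bigr => j _; rewrite !row_mxEr.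
Qed.

Lemma row_mx_scalar_bij d :
  bijective (fun k : int * 'rV[int]_d => row_mx (k.1%:M : 'rV_1) k.2 : 'rV_d.+1).
Proof.
exists (fun k : 'rV[int]_(1 + d) => (lsubmx k 0 0, rsubmx k)).
  by move=> [m k]; rewrite /= row_mxKl row_mxKr mxE eqxx mulr1n.
move=> k; rewrite -[RHS](hsubmxK (n1 := 1)); congr row_mx.
by apply/rowP => j; rewrite !ord1 !mxE eqxx mulr1n.
Qed.

(** Induction on the dimension: at a fixed first coordinate the series is a
    trigonometric series in the others, whose coefficients are themselves
    trigonometric series in that coordinate. *)
Lemma torus_integral_trig_series d (c : 'rV[int]_d -> R[i]) : csummable c ->
  torus_integral (fun x => Re (trig_series c x)) = (2 * pi) ^+ d * Re (c 0).
Proof.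
elim: d c => [|d IH] c sc.
  rewrite /= expr0 mul1r (rsum_single (i0 := 0 : 'rV[int]_0)).
    by rewrite /phase big_ord0 cis0 mulr1.
  by move=> k; rewrite thinmx0 eqxx.
rewrite /=; pose c2 m k' := c (row_mx (m%:M : 'rV_1) k').
have sc2 : csummable (fun k : int * 'rV[int]_d => c2 k.1 k.2).
  exact: (csummable_inj (bij_inj (row_mx_scalar_bij d)) sc).
have pi2 : 0 <= 2 * pi :> R by rewrite mulr_ge0 ?pi_ge0.
have [s1 s2] := csummable_pair sc2.
have sc2' : csummable (fun k : 'rV[int]_d * int => c2 k.2 k.1).
  have be : injective (fun k : 'rV[int]_d * int => (k.2, k.1)) by move=> [? ?] [? ?] [-> ->].
  exact: (csummable_inj be sc2).
have [s1' s2'] := csummable_pair sc2'.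
have inner s : torus_integral (fun y => Re (trig_series c (row_mx (s%:M : 'rV_1) y))) =
    (2 * pi) ^+ d * Re (csum (fun m => c2 m 0 * cis (m%:~R * s))).
  have scs : csummable (fun k : 'rV[int]_d * int => c2 k.2 k.1 * cis (k.2%:~R * s)).
    exact: csummable_phase.
  have [_ scs'] := csummable_pair scs.
  rewrite -(IH (fun k => csum (fun m => c2 m k * cis (m%:~R * s)))) //.
  congr torus_integral; apply/funext => y; congr Re; rewrite /trig_series.
  rewrite (csum_reindex _ (row_mx_scalar_bij d)) csum_pair; last first.
    by apply: csummable_phase.
  rewrite [LHS]csum_exchange; last exact: csummable_phase.
  apply: eq_csum => k; rewrite [RHS]mulrC -csumZ; last first.
    by apply: csummable_phase; exact: (s1' k).
  by apply: eq_csum => m; rewrite phase_row_mx cisD /c2 /=; ring.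
under eq_Rintegral do rewrite inner.
have sM : abs_summable (fun m => normc (c2 m 0)) by exact: (s1' 0).
have cont m : continuous (fun s : R => Re (c2 m 0 * cis (m%:~R * s))).
  have -> : (fun s : R => Re (c2 m 0 * cis (m%:~R * s))) =
      (fun s => Re (c2 m 0) * cos (m%:~R * s) - Im (c2 m 0) * sin (m%:~R * s)).
    by apply/funext => t; rewrite cReM.
  move=> s; apply/differentiable_continuous/derivable1_diffP.
  exact: ex_derive.
have bnd m s : `|Re (c2 m 0 * cis (m%:~R * s))| <= normc (c2 m 0).
  by apply: le_trans (normc_Re _) _; rewrite normcM normc_cis mulr1.
rewrite RintegralZl //; last first.
  apply: continuous_integrable => s /=.
  apply: (@rsum_cvg _ _ (nbhs s) _ _
    (fun s m => Re (c2 m 0 * cis (m%:~R * s))) _ _ sM).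
    by near=> y => m.
  by move=> m; exact: cont.
rewrite /= (@segment_integral_rsum _ _ _ _ (fun m s => Re (c2 m 0 * cis (m%:~R * s)))
  (fun m => normc (c2 m 0))) //.
under eq_rsum do rewrite integral_trig_monomial.
rewrite (rsum_single (i0 := 0 : int)); last by move=> m /negbTE ->.
rewrite eqxx exprSr mulrA; congr (_ * Re (c _)).
by apply/rowP => j; rewrite !mxE; case: splitP => i; rewrite ?ord1 !mxE ?mul0rn.
Unshelve. all: by end_near. Qed.

Lemma torus_Cintegral_trig_series d (c : 'rV[int]_d -> R[i]) : csummable c ->
  torus_Cintegral (trig_series c) = ((2 * pi) ^+ d)%:C * c 0.
Proof.
move=> sc; rewrite /torus_Cintegral.
have -> : (fun x => Im (trig_series c x)) =
    (fun x => Re (trig_series (fun k => - 'i%C * c k) x)).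
  apply/funext => x; rewrite /trig_series /csum /=; apply: eq_rsum => k.
  by rewrite -mulrA !cReM !cImM /=; ring.
rewrite !torus_integral_trig_series //; last exact: csummableZ.
by apply: eq_ReIm; rewrite ?cReM ?cImM /=; case: (c 0) => a b /=; ring.
Qed.

Lemma phaseB d (k l : 'rV[int]_d) (x : 'rV[R]_d) :
  phase (k - l) x = phase k x - phase l x.
Proof.
rewrite /phase -sumrB; apply: eq_bigr => j _.
by rewrite !mxE intrD rmorphN /= mulrBl.
Qed.

(** Multiplication by e^(-i k.x) translates the indices, so that the k-th
    coefficient becomes the mean value of a series. *)
Lemma fourier_coef_unique d m (f : 'rV[R]_d -> 'rV[R]_m) (j : 'I_m)
    (c : 'rV[int]_d -> R[i]) : csummable c ->
  (forall x, (f x 0 j)%:C = trig_series c x) ->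
  forall k, fourier_coef f k 0 j = c k.
Proof.
move=> sc fc k; rewrite /fourier_coef mxE.
have be : bijective (fun l : 'rV[int]_d => l + k).
  by exists (fun l => l - k) => l; rewrite ?addrK ?subrK.
have -> : (fun x => (f x 0 j)%:C * cis (- phase k x)) =
    trig_series (fun l => c (l + k)).
  apply/funext => x; rewrite fc /trig_series (csum_reindex _ be) mulrC -csumZ.
    apply: eq_csum => l.
    have -> : phase l x = phase (l + k) x - phase k x by rewrite -phaseB addrK.
    by rewrite cisD; ring.
  by apply: csummable_phase; exact: (csummable_inj (bij_inj be) sc).
rewrite torus_Cintegral_trig_series; last exact: (csummable_inj (bij_inj be) sc).
rewrite add0r mulrA -rmorphM /= mulVf ?mul1r //.
by rewrite expf_neq0 // mulf_neq0 // ?pnatr_eq0 // gt_eqF // pi_gt0.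
Qed.

End FourierCoefficients.

(** * Euclidean norm of wave vectors *)

Section IndexNorm.
Variables (R : realType) (d : nat).
Implicit Types k l : 'rV[int]_d.
Local Notation nrm := (index_norm R).

Lemma index_norm_ge0 k : 0 <= nrm k.
Proof. exact: sqrtr_ge0. Qed.

Lemma index_norm_sqr k : nrm k ^+ 2 = \sum_j ((k 0 j)%:~R) ^+ 2.
Proof. by rewrite sqr_sqrtr // sumr_ge0 // => j _; exact: sqr_ge0. Qed.

Lemma coord_le_index_norm k j : `|(k 0 j)%:~R| <= nrm k.
Proof.
rewrite -(ler_pXn2r (n := 2)) ?nnegrE ?normr_ge0 ?index_norm_ge0 //.
rewrite index_norm_sqr real_normK ?num_real // (bigD1 j) //= lerDl.
by rewrite sumr_ge0 // => i _; exact: sqr_ge0.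
Qed.

Lemma index_norm_ge1 k : k != 0 -> 1 <= nrm k.
Proof.
move=> k0.
have [j kj] : exists j, k 0 j != 0.
  apply: contrapT => h; move/negP: k0; apply; apply/eqP/rowP => j; rewrite mxE; apply/eqP.
  by apply: contrapT => /negP kj; apply: h; exists j.
apply: le_trans (coord_le_index_norm k j).
by rewrite -intr_norm ler1z -gtz0_ge1 normr_gt0.
Qed.

Lemma index_normN k : nrm (- k) = nrm k.
Proof.
congr Num.sqrt; apply: eq_bigr => j _.
by rewrite mxE rmorphN sqrrN.
Qed.

(** The Cauchy-Schwarz inequality for the two vectors once normalized is the
    nonnegativity of the sum of the squares of their differences. *)
Lemma index_normD k l : nrm (k + l) <= nrm k + nrm l.
Proof.
have [k0|k0] := eqVneq k 0.
  rewrite k0 add0r lerDr; exact: index_norm_ge0.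
have [l0|l0] := eqVneq l 0.
  rewrite l0 addr0 lerDl; exact: index_norm_ge0.
have pk : 0 < nrm k by apply: lt_le_trans (index_norm_ge1 k0).
have pl : 0 < nrm l by apply: lt_le_trans (index_norm_ge1 l0).
rewrite -(ler_pXn2r (n := 2)) ?nnegrE ?addr_ge0 ?index_norm_ge0 //.
rewrite sqrrD !index_norm_sqr.
have -> : \sum_j ((k + l) 0 j)%:~R ^+ 2 = \sum_j ((k 0 j)%:~R) ^+ 2 +
    (\sum_j (k 0 j)%:~R * (l 0 j)%:~R) *+ 2 + \sum_j ((l 0 j)%:~R) ^+ 2 :> R.
  rewrite -sumrMnl -!big_split; apply: eq_bigr => j _ /=.
  by rewrite mxE intrD sqrrD.
rewrite lerD2r lerD2l lerMn2r /=.
suff : 0 <= \sum_j ((k 0 j)%:~R / nrm k - (l 0 j)%:~R / nrm l) ^+ 2.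
  have -> : \sum_j ((k 0 j)%:~R / nrm k - (l 0 j)%:~R / nrm l) ^+ 2 =
      (\sum_j ((k 0 j)%:~R) ^+ 2) / nrm k ^+ 2 -
      (\sum_j (k 0 j)%:~R * (l 0 j)%:~R) * (2 / (nrm k * nrm l)) +
      (\sum_j ((l 0 j)%:~R) ^+ 2) / nrm l ^+ 2.
    rewrite !mulr_suml -sumrB -big_split; apply: eq_bigr => j _ /=.
    by field; rewrite !gt_eqF.
  rewrite -!index_norm_sqr !divff ?expf_neq0 ?gt_eqF // => h.
  have : (\sum_j (k 0 j)%:~R * (l 0 j)%:~R) * (2 / (nrm k * nrm l)) <= 2 by lra.
  by rewrite mulrCA -[leRHS]mulr1 ler_pM2l // ler_pdivrMr ?mulr_gt0 // mul1r.
by rewrite sumr_ge0 // => j _; exact: sqr_ge0.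
Qed.

End IndexNorm.

(** * Convolution of coefficient families *)

Section Convolution.
Variables (R : realType) (d : nat).
Local Notation I := (nat * 'rV[int]_d)%type.

Definition idx_add (i j : I) : I := ((i.1 + j.1)%N, i.2 + j.2).
Definition idx_sub (i j : I) : I := ((i.1 - j.1)%N, i.2 - j.2).

(** Time exponents are natural numbers, so the product only sees pairs whose
    time indices add up to that of [i]; the test rules out the truncated
    subtraction. *)
Definition convol (a b : I -> R[i]) (i : I) : R[i] :=
  csum (fun j : I => if (j.1 <= i.1)%N then a j * b (idx_sub i j) else 0).

(** Sends a pair of factors of a product to the index of the product together
    with the first factor; its image consists of the pairs met in [convol]. *)
Definition regroup (p : I * I) : I * I := (idx_add p.1 p.2, p.1).

Lemma regroup_inj : injective regroup.
Proof.
move=> [[m k] [n l]] [[m' k'] [n' l']]; rewrite /regroup /idx_add /=.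
move=> [e1 e2 e3 e4]; rewrite e3 e4 in e1 e2 *.
by move/addnI: e1 => ->; move/addrI: e2 => ->.
Qed.

Lemma notin_regroup (q : I * I) : (forall p, q <> regroup p) -> ~~ (q.2.1 <= q.1.1)%N.
Proof.
move: q => [[n a] [m b]] h /=; apply/negP => mn; apply: (h ((m, b), ((n - m)%N, a - b))).
by rewrite /regroup /idx_add /= subnKC // addrC subrK.
Qed.

Lemma idx_addK (j l : I) : idx_sub (idx_add j l) j = l.
Proof. by case: l => n k; rewrite /idx_sub /idx_add /= addKn addrC addKr. Qed.

Lemma convol_norm_le (w : I -> R) (a b : I -> R[i]) : (forall i, 0 <= w i) ->
  (\esumT_i (w i * normc (convol a b i))%:E <=
   2%:E * \esumT_p (w (idx_add p.1 p.2) * (normc (a p.1) * normc (b p.2)))%:E)%E.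
Proof.
move=> w0; have n0 := @normc_ge0 R.
pose F (q : I * I) : \bar R := if (q.2.1 <= q.1.1)%N then
   (w q.1 * (normc (a q.2) * normc (b (idx_sub q.1 q.2))))%:E else 0%E.
have F0 q : (0 <= F q)%E.
  by rewrite /F; case: ifP => _ //; rewrite lee_fin !mulr_ge0.
have -> : \esumT_p (w (idx_add p.1 p.2) * (normc (a p.1) * normc (b p.2)))%:E =
    \esumT_q F q.
  rewrite [RHS](esumT_inj regroup_inj); last first.
    by move=> q /notin_regroup/negbTE h; rewrite /F h.
  apply: eq_esumT => -[j l]; rewrite /F /regroup /= leq_addr.
  by rewrite idx_addK.
rewrite [X in (_ <= _ * X)%E]esumT_pair // -esumTZ //; last first.
  by move=> i; exact: esumT_ge0.
apply: esumT_le => i; rewrite EFinM.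
apply: le_trans (lee_wpmul2l _ (csum_norm _)) _; first by rewrite lee_fin.
rewrite muleCA lee_pmul2l // -esumTZ //; last by move=> j; rewrite lee_fin.
apply: esumT_le => j; rewrite /F /=; case: ifP => _.
  by rewrite -EFinM normcM.
by rewrite normc_zero mule0.
Qed.

(** The product of two series, regrouped by the index of the product. For
    a multiplicative [phi], such as a monomial t^n e^(i k.x) in its exponents,
    this is again a series in [phi]. *)
Lemma csum_convol (a b phi : I -> R[i]) :
  (forall i j, phi (idx_add i j) = phi i * phi j) ->
  csummable (fun i => a i * phi i) -> csummable (fun i => b i * phi i) ->
  csum (fun i => a i * phi i) * csum (fun i => b i * phi i) =
    csum (fun i => convol a b i * phi i).
Proof.
move=> phiM sa sb; rewrite csum_prod //.
have sp := csummable_prod sa sb.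
pose F (q : I * I) : R[i] := if (q.2.1 <= q.1.1)%N then
   phi q.1 * (a q.2 * b (idx_sub q.1 q.2)) else 0.
have FE p : F (regroup p) = a p.1 * phi p.1 * (b p.2 * phi p.2).
  by rewrite /F /regroup /= leq_addr idx_addK phiM; ring.
have F0 q : (forall p, q <> regroup p) -> F q = 0.
  by move=> /notin_regroup/negbTE h; rewrite /F h.
have sF : csummable F.
  rewrite csummableE (esumT_inj regroup_inj); last first.
    by move=> q /F0 ->; rewrite normc_zero.
  rewrite (eq_esumT (b := fun p => (normc (a p.1 * phi p.1 * (b p.2 * phi p.2)))%:E)).
    by move: sp; rewrite csummableE.
  by move=> p; rewrite FE.
transitivity (csum F).
  rewrite (csum_inj regroup_inj F0); apply: eq_csum => p.
  by rewrite FE.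
rewrite csum_pair //; apply: eq_csum => i.
rewrite /convol mulrC.
have [pi0|pi0] := eqVneq (phi i) 0.
  rewrite pi0 mul0r -(csum0 R I); apply: eq_csum => j; rewrite /F pi0 mul0r.
  by case: ifP.
rewrite -csumZ.
  by apply: eq_csum => j; rewrite /F /=; case: ifP; rewrite // mulr0.
have [/(_ i) + _] := csummable_pair sF.
move=> /(csummableZ (phi i)^-1); congr csummable; apply/funext => j.
by rewrite /F /=; case: ifP; rewrite ?mulr0 // mulKf.
Qed.

Lemma summable_convol (a b : I -> R[i]) (w : I -> R) : (forall i, 0 <= w i) ->
  (forall i j, w (idx_add i j) <= w i * w j) ->
  abs_summable (fun i => w i * normc (a i)) ->
  abs_summable (fun i => w i * normc (b i)) ->
  abs_summable (fun i => w i * normc (convol a b i)).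
Proof.
move=> w0 wM sa sb; have n0 := @normc_ge0 R.
apply: summable_fin; first by move=> i; rewrite mulr_ge0.
apply: le_lt_trans (convol_norm_le a b w0) _.
have wa0 i : 0 <= w i * normc (a i) by rewrite mulr_ge0.
have wb0 i : 0 <= w i * normc (b i) by rewrite mulr_ge0.
have h : (\esumT_p (w (idx_add p.1 p.2) * (normc (a p.1) * normc (b p.2)))%:E <=
   (nsum (fun i => w i * normc (a i)) * nsum (fun i => w i * normc (b i)))%:E)%E.
  apply: le_trans (esumT_prod wa0 wb0 _ _); last 2 first.
  - by rewrite nsumE.
  - by rewrite nsumE.
  apply: esumT_le => -[i j] /=; rewrite lee_fin.
  rewrite [leRHS](_ : _ = (w i * w j) * (normc (a i) * normc (b j))); last by ring.
  by rewrite ler_wpM2r // mulr_ge0.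
by apply: le_lt_trans (lee_wpmul2l _ h) _; rewrite -?EFinM ?ltry // lee_fin.
Qed.

End Convolution.

(** * Numerical estimates *)

Section NumericBounds.
Variable R : realType.

Lemma sum_inv_sqr_le n : \sum_(m < n.+1) (m.+1%:R ^+ 2)^-1 <= 2 - n.+1%:R^-1 :> R.
Proof.
elim: n => [|n IH]; first by rewrite big_ord1 expr1n invr1; lra.
rewrite big_ord_recr /=; apply: le_trans (lerD IH (lexx _)) _.
have a0 : 0 < n.+1%:R :> R by rewrite ltr0n.
have -> : n.+2%:R = n.+1%:R + 1 :> R by rewrite -natr1.
move: (n.+1%:R : R) a0 => a a0.
have a1 : 0 < a + 1 by rewrite addr_gt0.
have -> : 2 - a^-1 + ((a + 1) ^+ 2)^-1 = 2 - (a + 1)^-1 - (a * (a + 1) ^+ 2)^-1.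
  by field; rewrite !gt_eqF.
by rewrite gerBl invr_ge0 mulr_ge0 ?sqr_ge0 // ltW.
Qed.

(** Multiplying by n + 2 = (m + 1) + (n - m + 1) leaves inverse squares and a
    product of inverses, itself at most half the sum of two inverse squares; the
    inverse squares sum to at most 2. *)
Lemma sum_weights_le n :
  \sum_(m < n.+1) (m.+1%:R ^+ 2 * (n - m).+1%:R)^-1 <= 4 / n.+2%:R :> R.
Proof.
pose a (m : nat) : R := m.+1%:R^-1.
have a0 m : 0 < a m by rewrite invr_gt0 ltr0n.
have Q : \sum_(m < n.+1) a m ^+ 2 <= 2.
  apply: (@le_trans _ _ (2 - n.+1%:R^-1)); last by rewrite gerBl invr_ge0.
  apply: le_trans (sum_inv_sqr_le n); apply: ler_sum => m _.
  by rewrite /a exprVn.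
have Q' : \sum_(m < n.+1) a (n - m)%N ^+ 2 <= 2.
  apply: le_trans Q; rewrite (reindex_inj rev_ord_inj) /=.
  by apply: ler_sum => m _; rewrite subSS subKn // -ltnS.
have n2 : 0 < n.+2%:R :> R by rewrite ltr0n.
rewrite ler_pdivlMr // mulr_suml.
(* 3 / 2 is 1 plus the 1 / 2 of the inequality of means. *)
apply: (@le_trans _ _ (\sum_(m < n.+1) (2^-1 * a (n - m)%N ^+ 2 + 3 / 2 * a m ^+ 2))).
  apply: ler_sum => m _.
  have -> : n.+2%:R = m.+1%:R + (n - m).+1%:R :> R.
    by rewrite -natrD addSn addnS subnKC // -ltnS.
  have p1 : 0 < m.+1%:R :> R by rewrite ltr0n.
  have p2 : 0 < (n - m).+1%:R :> R by rewrite ltr0n.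
  have -> : (m.+1%:R ^+ 2 * (n - m).+1%:R)^-1 * (m.+1%:R + (n - m).+1%:R) =
      a m * a (n - m)%N + a m ^+ 2.
    by rewrite /a; field; rewrite !gt_eqF.
  have := sqr_ge0 (a m - a (n - m)%N); rewrite sqrrB; lra.
rewrite big_split /= -!mulr_sumr; lra.
Qed.

(** The ratio is 1 + 1 / (n + 1) <= e^(1 / (n + 1)). *)
Lemma pow_ratio_le_e n : (n.+2%:R / n.+1%:R) ^+ n <= expR 1 :> R.
Proof.
have n1 : 0 < n.+1%:R :> R by rewrite ltr0n.
have h1 : 1 <= n.+2%:R / n.+1%:R :> R.
  by rewrite ler_pdivlMr // mul1r ler_nat.
apply: (@le_trans _ _ ((n.+2%:R / n.+1%:R) ^+ n.+1)).
  by rewrite exprS ler_peMl // exprn_ge0 // (le_trans ler01).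
have -> : expR 1 = (expR n.+1%:R^-1) ^+ n.+1 :> R.
  by rewrite -expRM_natl mulfV // gt_eqF.
rewrite lerXn2r // ?nnegrE ?expR_ge0 ?(le_trans ler01) //.
apply: le_trans (expR_ge1Dx _).
by rewrite -natr1 mulrDl divff ?gt_eqF // mul1r.
Qed.

Lemma esumT_ord n (a : 'I_n -> \bar R) : (forall i, 0 <= a i)%E ->
  \esumT_i a i = (\sum_(i < n) a i)%E.
Proof.
move=> a0; rewrite esum_fset //; last exact: finite_finset.
have -> : [set: 'I_n] = [set` enum 'I_n].
  by apply/seteqP; split => i //= _; rewrite mem_enum.
by rewrite -fsbig_seq ?enum_uniq // big_enum.
Qed.

Lemma geometric_summable (M q : R) : 0 <= M -> 0 <= q < 1 ->
  abs_summable (fun n : nat => M * q ^+ n).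
Proof.
move=> M0 /andP[q0 q1].
have t0 n : 0 <= M * q ^+ n by rewrite mulr_ge0 // exprn_ge0.
apply: summable_fin => //.
rewrite -nneseries_esumT //.
apply: (@le_lt_trans _ _ (M / (1 - q))%:E); last by rewrite ltry.
apply: lime_le; first by apply: is_cvg_nneseries => n _ _; rewrite lee_fin.
near=> n; rewrite sumEFin lee_fin.
have q1' : 0 < 1 - q by rewrite subr_gt0.
rewrite -mulr_sumr ler_wpM2l // -[leRHS]mul1r ler_pdivlMr //.
elim: {+}n => [|k IH]; first by rewrite big_geq // mul0r.
suff -> : (\sum_(0 <= i < k.+1) q ^+ i) * (1 - q) = 1 - q ^+ k.+1.
  by rewrite gerBl exprn_ge0.
by rewrite mulrC -[RHS]opprB -[1 - q]opprB mulNr subrX1 big_mkord.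
Unshelve. all: by end_near. Qed.

End NumericBounds.

(** * The recursion for the coefficients *)

Section Leray.
Variables (R : realType) (d : nat).
Local Notation nrm := (index_norm R).
Local Notation I := (nat * 'rV[int]_d)%type.
Implicit Types (k : 'rV[int]_d) (N : 'I_d -> R[i]).

Definition wavenumber k j : R := (k 0 j)%:~R.

Definition kdot k N : R[i] := \sum_l (wavenumber k l)%:C * N l.

(** The Fourier multiplier of the orthogonal projection on divergence-free
    fields; at k = 0, division by zero makes it the identity, as it should be. *)
Definition leray k N j : R[i] :=
  N j - (wavenumber k j / nrm k ^+ 2)%:C * kdot k N.

Lemma kdot_norm k N : normc (kdot k N) <= nrm k * \sum_j normc (N j).
Proof.
apply: le_trans (normc_sum _ _ _) _; rewrite mulr_sumr; apply: ler_sum => j _.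
by rewrite normcM normc_real ler_wpM2r ?normc_ge0 // coord_le_index_norm.
Qed.

(** Bounding the gradient part crudely, by Cauchy-Schwarz in each component, is
    enough: only the existence of some constant matters. *)
Lemma leray_norm k N :
  \sum_j normc (leray k N j) <= d.+1%:R * \sum_j normc (N j).
Proof.
have S0 : 0 <= \sum_j normc (N j) by apply: sumr_ge0 => j _; exact: normc_ge0.
have h j : normc ((wavenumber k j / nrm k ^+ 2)%:C * kdot k N) <= \sum_j normc (N j).
  rewrite normcM normc_real normrM normfV.
  have [->|k0] := eqVneq k 0.
    by rewrite /wavenumber mxE normr0 !mul0r.
  have k1 := index_norm_ge1 R k0; have kp : 0 < nrm k by apply: lt_le_trans k1.
  rewrite (ger0_norm (sqr_ge0 _)) mulrAC ler_pdivrMr ?exprn_gt0 //.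
  apply: (@le_trans _ _ (nrm k * (nrm k * \sum_j normc (N j)))).
    by rewrite ler_pM ?normc_ge0 ?kdot_norm ?coord_le_index_norm.
  by rewrite expr2 mulrCA !mulrA mulrC mulrA.
apply: (@le_trans _ _ (\sum_(j < d) (normc (N j) + \sum_j normc (N j)))).
  apply: ler_sum => j _; apply: le_trans (normcD _ _) _.
  by rewrite normcN lerD2l.
rewrite big_split /= sumr_const card_ord -[d.+1]addn1 natrD mulrDl mul1r.
by rewrite mulr_natl addrC.
Qed.

Lemma kdot_leray k N : k != 0 -> kdot k (leray k N) = 0.
Proof.
move=> k0; have kp : nrm k != 0 by rewrite gt_eqF // (lt_le_trans _ (index_norm_ge1 R k0)).
rewrite {1}/kdot /leray.
under eq_bigr do rewrite mulrBr mulrA -rmorphM /=.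
rewrite sumrB -/(kdot k N) -mulr_suml -rmorph_sum /=.
rewrite (_ : \sum_j _ = 1) ?mul1r ?subrr //.
under eq_bigr do rewrite mulrA -expr2.
by rewrite -mulr_suml -index_norm_sqr divff // expf_neq0.
Qed.

(** The coefficients of a partial derivative in space. *)
Definition dxc j (a : I -> R[i]) (i : I) : R[i] :=
  (0 +i* wavenumber i.2 j) * a i.

Lemma normc_dxc j (a : I -> R[i]) i :
  normc (dxc j a i) <= nrm i.2 * normc (a i).
Proof.
rewrite normcM ler_wpM2r ?normc_ge0 //=.
by rewrite expr0n add0r sqrtr_sqr coord_le_index_norm.
Qed.

(** The coefficients of the components of (u . nabla) u. *)
Definition nonlin (U : 'I_d -> I -> R[i]) (j : 'I_d) (i : I) : R[i] :=
  \sum_l convol (U l) (dxc l (U j)) i.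

Definition velocity_recursion (c0 : 'I_d -> 'rV[int]_d -> R[i])
    (U : 'I_d -> I -> R[i]) :=
  (forall j k, U j (0%N, k) = c0 j k) /\
  (forall j n k, U j (n.+1, k) =
     - (n.+1%:R^-1)%:C * leray k (fun l => nonlin U l (n, k)) j).

(** The recursion uses all earlier levels, through convolutions. Stage [n] is a
    whole family of coefficients, correct at the levels up to [n]. *)
Fixpoint velocity_upto (c0 : 'I_d -> 'rV[int]_d -> R[i]) (n : nat) :
    'I_d -> I -> R[i] :=
  if n is m.+1 then fun j i =>
    if i.1 == n then
      - (n%:R^-1)%:C *
        leray i.2 (fun l => nonlin (velocity_upto c0 m) l (m, i.2)) j
    else velocity_upto c0 m j i
  else fun j i => c0 j i.2.

Definition velocity_coef c0 (j : 'I_d) (i : I) : R[i] := velocity_upto c0 i.1 j i.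

Lemma velocity_upto_coef c0 n j i : (i.1 <= n)%N ->
  velocity_upto c0 n j i = velocity_coef c0 j i.
Proof.
case: i => m k /=; elim: n => [|n IH]; first by rewrite leqn0 => /eqP ->.
rewrite leq_eqVlt => /orP[/eqP ->|]; first by [].
by rewrite ltnS => mn /=; rewrite ltn_eqF ?ltnS // IH.
Qed.

Lemma velocity_upto_diag c0 n j k : velocity_upto c0 n.+1 j (n.+1, k) =
  - (n.+1%:R^-1)%:C * leray k (fun l => nonlin (velocity_upto c0 n) l (n, k)) j.
Proof.
have velocity_uptoS i : velocity_upto c0 n.+1 j i =
    if i.1 == n.+1 then - (n.+1%:R^-1)%:C *
      leray i.2 (fun l => nonlin (velocity_upto c0 n) l (n, i.2)) j
    else velocity_upto c0 n j i by [].
by rewrite velocity_uptoS eqxx.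
Qed.

Lemma velocity_coef_recursion c0 : velocity_recursion c0 (velocity_coef c0).
Proof.
split=> [//|j n k]; rewrite [LHS]velocity_upto_diag.
suff -> : (fun l => nonlin (velocity_upto c0 n) l (n, k)) =
    (fun l => nonlin (velocity_coef c0) l (n, k)) by [].
apply/funext => l; apply: eq_bigr => l' _; apply: eq_csum => -[m b].
case: ifP => // mn; rewrite /dxc !velocity_upto_coef //.
exact: leq_subr.
Qed.

End Leray.

(** * The Cauchy-Kovalevskaya estimate *)

Section LevelBounds.
Variables (R : realType) (d : nat).
Local Notation nrm := (index_norm R).
Local Notation I := (nat * 'rV[int]_d)%type.

(** Only the pairs of levels adding up to [n] contribute, and for each of them
    the double sum factors. *)
Lemma level_prod_le (X Y : I -> R) (n : nat) (x y : nat -> R) :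
  (forall i, 0 <= X i) -> (forall i, 0 <= Y i) ->
  (forall m, (m <= n)%N -> (\esumT_k (X (m, k))%:E <= (x m)%:E)%E) ->
  (forall m, (m <= n)%N -> (\esumT_k (Y (m, k))%:E <= (y m)%:E)%E) ->
  (\esumT_p (if (p.1.1 + p.2.1 == n)%N then X p.1 * Y p.2 else 0)%:E <=
   (\sum_(m < n.+1) x m * y (n - m)%N)%:E)%E.
Proof.
move=> X0 Y0 hx hy.
pose e (q : 'I_n.+1 * ('rV[int]_d * 'rV[int]_d)) : I * I :=
  ((val q.1, q.2.1), ((n - q.1)%N, q.2.2)).
have ie : injective e.
  move=> [m [k l]] [m' [k' l']] [mm' -> _ ->].
  by congr (_, _); exact: val_inj.
rewrite (esumT_inj ie); last first.
  move=> [[m k] [m' l]] h /=; case: eqP => // mn.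
  have mn1 : (m < n.+1)%N by rewrite ltnS -mn leq_addr.
  by case: (h (Ordinal mn1, (k, l))); rewrite /e /= -mn addKn.
have t0 q : (0 <= (if ((e q).1.1 + (e q).2.1 == n)%N then X (e q).1 * Y (e q).2 else 0)%:E)%E.
  by case: ifP => _ //; rewrite lee_fin mulr_ge0.
rewrite esumT_pair // esumT_ord; last by move=> m; apply: esumT_ge0.
rewrite -sumEFin; apply: lee_sum => m _.
have mn : (m <= n)%N by rewrite -ltnS.
apply: le_trans (esumT_prod (x := fun k => X (val m, k))
  (y := fun l => Y ((n - m)%N, l)) _ _ (hx _ mn) (hy _ (leq_subr _ _))) => //.
by apply: esumT_le => -[k l] /=; rewrite subnKC // eqxx.
Qed.

Variables (c0 : 'I_d -> 'rV[int]_d -> R[i]) (U : 'I_d -> I -> R[i]).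
Hypothesis hU : velocity_recursion c0 U.

Let v (i : I) : R := \sum_j normc (U j i).

Let v0 i : 0 <= v i.
Proof. by apply: sumr_ge0 => j _; exact: normc_ge0. Qed.

Definition level_norm (n : nat) (z : R) : \bar R :=
  \esumT_k (expR (z * nrm k) * \sum_j normc (U j (n, k)))%:E.

Definition level_dnorm (n : nat) (z : R) : \bar R :=
  \esumT_k (expR (z * nrm k) * (nrm k * \sum_j normc (U j (n, k))))%:E.

(** The weight is arbitrary so that a single level can be selected with a
    weight supported there. *)
Lemma nonlin_weighted_le (w : I -> R) : (forall i, 0 <= w i) ->
  (\esumT_i (w i * \sum_j normc (nonlin U j i))%:E <=
   2%:E * \esumT_p (w (idx_add p.1 p.2) * (v p.1 * (nrm p.2.2 * v p.2)))%:E)%E.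
Proof.
move=> w0; have n0 := @normc_ge0 R.
apply: (@le_trans _ _ (\esumT_i (\sum_j \sum_l
    (w i * normc (convol (U l) (dxc l (U j)) i))%:E))%E).
  apply: esumT_le => i; rewrite mulr_sumr -sumEFin; apply: lee_sum => j _.
  by rewrite sumEFin lee_fin -mulr_sumr ler_wpM2l // normc_sum.
rewrite esumT_sum; last by move=> j i; apply: sume_ge0 => l _; rewrite lee_fin mulr_ge0.
apply: (@le_trans _ _ (\sum_j \sum_l 2%:E * \esumT_p (w (idx_add p.1 p.2) *
    (normc (U l p.1) * (nrm p.2.2 * normc (U j p.2))))%:E)%E).
  apply: lee_sum => j _.
  rewrite esumT_sum; last by move=> l i; rewrite lee_fin mulr_ge0.
  apply: lee_sum => l _; apply: le_trans (convol_norm_le _ _ w0) _.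
  rewrite lee_pmul2l //; apply: esumT_le => p; rewrite lee_fin.
  by rewrite !ler_wpM2l // normc_dxc.
have S0 j p : 0 <= w (idx_add p.1 p.2) * (v p.1 * (nrm p.2.2 * normc (U j p.2))).
  by rewrite !mulr_ge0 // index_norm_ge0.
have E j : (\sum_l (2%:E * (\esumT_p (w (idx_add p.1 p.2) *
    (normc (U l p.1) * (nrm p.2.2 * normc (U j p.2))))%:E)))%E =
    (2%:E * \esumT_p (w (idx_add p.1 p.2) *
    (v p.1 * (nrm p.2.2 * normc (U j p.2))))%:E)%E.
  rewrite -ge0_sume_distrr -?esumT_sum; first last.
  - move=> l _; apply: esumT_ge0 => p.
    by rewrite lee_fin !mulr_ge0 // index_norm_ge0.
  - by move=> l p; rewrite lee_fin !mulr_ge0 // index_norm_ge0.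
  congr (_ * _)%E; apply: eq_esumT => p; rewrite sumEFin; congr EFin.
  by rewrite -mulr_sumr -mulr_suml.
under eq_bigr do rewrite E.
rewrite -ge0_sume_distrr -?esumT_sum; first last.
- by move=> j _; apply: esumT_ge0 => p; rewrite lee_fin.
- by move=> j p; rewrite lee_fin.
rewrite lee_pmul2l //; apply: esumT_le => p; rewrite sumEFin lee_fin.
by rewrite -!mulr_sumr.
Qed.

(** The exponential weight is submultiplicative by the triangle inequality, so
    a level of the convolution is bounded by a Cauchy product. *)
Lemma level_norm_step n z (x y : nat -> R) : 0 <= z ->
  (forall m, (m <= n)%N -> (level_norm m z <= (x m)%:E)%E) ->
  (forall m, (m <= n)%N -> (level_dnorm m z <= (y m)%:E)%E) ->
  (level_norm n.+1 z <=
    (d.+1%:R / n.+1%:R * 2 * \sum_(m < n.+1) x m * y (n - m)%N)%:E)%E.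
Proof.
move=> z0 hx hy; have e0 := @expR_ge0 R.
pose w (i : I) := if i.1 == n then expR (z * nrm i.2) else 0.
have w0 i : 0 <= w i by rewrite /w; case: ifP.
have c0' : 0 <= d.+1%:R / n.+1%:R :> R by rewrite divr_ge0.
apply: (@le_trans _ _ ((d.+1%:R / n.+1%:R)%:E *
    \esumT_i (w i * \sum_j normc (nonlin U j i))%:E)%E).
  have ie : injective (fun k : 'rV[int]_d => (n, k)) by move=> k l [].
  rewrite (esumT_inj ie); last first.
    move=> [m k] h; rewrite /w /=; case: eqP => [mn|_]; last by rewrite mul0r.
    by case: (h k); rewrite mn.
  rewrite -esumTZ //; last first.
    by move=> k; rewrite lee_fin mulr_ge0 // sumr_ge0 // => j _; exact: normc_ge0.
  apply: esumT_le => k; rewrite -EFinM lee_fin /w /= eqxx mulrCA ler_wpM2l //.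
  rewrite mulrAC ler_pdivlMr ?ltr0n //.
  apply: le_trans (leray_norm k (fun l => nonlin U l (n, k))).
  rewrite mulr_suml; apply: ler_sum => j _.
  case: hU => _ ->; rewrite normcM normcN normc_real ger0_norm ?invr_ge0 //.
  by rewrite mulrC mulrA mulfV ?mul1r // pnatr_eq0.
rewrite -mulrA [leRHS]EFinM; apply: lee_wpmul2l; first by rewrite lee_fin.
apply: le_trans (nonlin_weighted_le w0) _.
rewrite EFinM lee_pmul2l //.
apply: le_trans (level_prod_le (X := fun i => expR (z * nrm i.2) * v i)
  (Y := fun i => expR (z * nrm i.2) * (nrm i.2 * v i)) _ _ hx hy).
- apply: esumT_le => -[[m k] [m' l]] /=; rewrite lee_fin /w /=.
  case: ifP => _; last by rewrite mul0r.
  rewrite [leRHS](_ : _ = expR (z * nrm k) * expR (z * nrm l) * (v (m, k) * (nrm l * v (m', l)))); last by ring.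
  rewrite ler_wpM2r ?mulr_ge0 ?index_norm_ge0 // -expRD ler_expR -mulrDr.
  by rewrite ler_wpM2l // index_normD.
- by move=> i; rewrite mulr_ge0.
- by move=> i; rewrite !mulr_ge0 // index_norm_ge0.
Qed.

(** Cauchy estimate: by x <= e^x, a derivative costs an arbitrarily small part
    of the radius of analyticity. *)
Lemma level_dnorm_le n (z z' : R) : z < z' ->
  (level_dnorm n z <= ((z' - z)^-1)%:E * level_norm n z')%E.
Proof.
move=> zz'; have p : 0 < z' - z by rewrite subr_gt0.
rewrite -esumTZ ?invr_ge0 ?(ltW p) //; last first.
  by move=> k; rewrite lee_fin mulr_ge0 //; exact: (v0 (n, k)).
apply: esumT_le => k; rewrite -EFinM lee_fin !mulrA ler_wpM2r //; first exact: (v0 (n, k)).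
rewrite mulrC ler_pdivlMl // mulrA.
have -> : expR (z' * nrm k) = expR ((z' - z) * nrm k) * expR (z * nrm k).
  by rewrite -expRD -mulrDl subrK.
rewrite ler_wpM2r ?expR_ge0 //.
by apply: le_trans (expR_ge1Dx _); rewrite lerDr.
Qed.

(** Induction on the level. The derivative at level m is estimated with the
    fraction 1 / (m + 2) of the remaining radius, which costs a factor of order
    m + 1 and a power bounded by e. *)
Lemma level_norm_bound (rho M : R) : 0 < M ->
  (level_norm 0 rho <= M%:E)%E ->
  let K := 32 * d.+1%:R * expR 1 * M in
  forall n z, 0 <= z -> z < rho ->
  (level_norm n z <= (M / n.+1%:R ^+ 2 * (K / (rho - z)) ^+ n)%:E)%E.
Proof.
move=> M0 hM K; have e0 : 0 < expR 1 :> R by exact: expR_gt0.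
have K0 : 0 < K by rewrite !mulr_gt0.
elim/ltn_ind => -[|n] IH z z0 zr.
  rewrite expr0 mulr1 expr1n divr1; apply: le_trans hM.
  apply: esumT_le => k; rewrite lee_fin ler_wpM2r //; first exact: (v0 (0%N, k)).
  rewrite ler_expR.
  by rewrite ler_wpM2r ?index_norm_ge0 // ltW.
have D0 : 0 < rho - z by rewrite subr_gt0.
pose D := rho - z; rewrite -/D in D0 *.
pose x m := M / m.+1%:R ^+ 2 * (K / D) ^+ m.
pose y m := 2 * expR 1 * M / m.+1%:R * K ^+ m / D ^+ m.+1.
have hx m : (m <= n)%N -> (level_norm m z <= (x m)%:E)%E.
  by move=> mn; apply: IH.
have hy m : (m <= n)%N -> (level_dnorm m z <= (y m)%:E)%E.
  move=> mn; pose z' := z + D / m.+2%:R.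
  have Dm : 0 < D / m.+2%:R by rewrite divr_gt0.
  have zz' : z < z' by rewrite ltrDl.
  have z'r : z' < rho.
    rewrite -ltrBrDl ltr_pdivrMr ?ltr0n // -/D -[ltLHS]mulr1 ltr_pM2l //.
    by rewrite ltr1n.
  apply: le_trans (level_dnorm_le m zz') _.
  have h := IH m mn z' (ltW (le_lt_trans z0 zz')) z'r.
  apply: le_trans (lee_wpmul2l _ h) _.
    by rewrite lee_fin invr_ge0 ltW // subr_gt0.
  rewrite -EFinM lee_fin.
  have m1 : 0 < m.+1%:R :> R by rewrite ltr0n.
  have m2 : 0 < m.+2%:R :> R by rewrite ltr0n.
  have m12 : m.+2%:R = m.+1%:R + 1 :> R by rewrite -natr1.
  have m11 : 1 <= m.+1%:R :> R by rewrite ler1n.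
  have -> : z' - z = D / m.+2%:R by rewrite /z' addrC addKr.
  have -> : rho - z' = D * (m.+1%:R / m.+2%:R).
    have m2' : m.+1%:R + 1 != 0 :> R by rewrite -m12 gt_eqF.
    rewrite /z' opprD addrA -/D m12; move: (m.+1%:R : R) m2' => a a1.
    by field.
  have -> : (D / m.+2%:R)^-1 * (M / m.+1%:R ^+ 2 * (K / (D * (m.+1%:R / m.+2%:R))) ^+ m) =
     (M / m.+1%:R * K ^+ m / D ^+ m.+1) * ((m.+2%:R / m.+1%:R) * (m.+2%:R / m.+1%:R) ^+ m).
    have -> : K / (D * (m.+1%:R / m.+2%:R)) = K / D * (m.+2%:R / m.+1%:R).
      move: (m.+1%:R : R) (m.+2%:R : R) m1 m2 => a b a0 b0.
      by field; rewrite !gt_eqF.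
    rewrite (exprMn m (K / D)) (expr_div_n K D m) (exprS D m).
    move: ((m.+2%:R / m.+1%:R) ^+ m) (K ^+ m) (D ^+ m) (exprn_gt0 m D0) => X Y Z Z0.
    move: (m.+1%:R : R) (m.+2%:R : R) m1 m2 => a b a0 b0.
    by field; rewrite !gt_eqF.
  rewrite [leRHS](_ : _ = (M / m.+1%:R * K ^+ m / D ^+ m.+1) * (2 * expR 1)); last first.
    by rewrite /y; ring.
  apply: ler_wpM2l.
    by rewrite !mulr_ge0 ?invr_ge0 ?exprn_ge0 // ltW.
  apply: ler_pM; last exact: pow_ratio_le_e.
  - by rewrite divr_ge0.
  - by rewrite exprn_ge0 // divr_ge0.
  - by rewrite ler_pdivrMr // m12; lra.
apply: le_trans (level_norm_step z0 hx hy) _; rewrite lee_fin.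
have n1 : 0 < n.+1%:R :> R by rewrite ltr0n.
have n2 : 0 < n.+2%:R :> R by rewrite ltr0n.
have n12 : n.+2%:R = n.+1%:R + 1 :> R by rewrite -natr1.
have n11 : 1 <= n.+1%:R :> R by rewrite ler1n.
have -> : \sum_(m < n.+1) x m * y (n - m)%N =
    2 * expR 1 * M ^+ 2 * K ^+ n / D ^+ n.+1 *
    \sum_(m < n.+1) (m.+1%:R ^+ 2 * (n - m).+1%:R)^-1.
  rewrite mulr_sumr; apply: eq_bigr => m _; rewrite /x /y.
  have mn : (m <= n)%N by rewrite -ltnS.
  have pw (a : R) : a ^+ n = a ^+ m * a ^+ (n - m) by rewrite -exprD subnKC.
  rewrite (expr_div_n K D m) (exprS D (n - m)) (exprS D n) (pw K) (pw D).
  move: (exprn_gt0 m D0) (exprn_gt0 (n - m) D0).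
  have m1 : 0 < m.+1%:R :> R by rewrite ltr0n.
  have m2 : 0 < (n - m).+1%:R :> R by rewrite ltr0n.
  move: (m.+1%:R : R) ((n - m).+1%:R : R) m1 m2 => a b a0 b0.
  move: (K ^+ m) (K ^+ (n - m)) (D ^+ m) (D ^+ (n - m)) => A B A' B' A0 B0.
  by field; rewrite !gt_eqF.
(* The factor 32 in K: 2 from the modulus of sums, 2 from (m + 2) / (m + 1),
   4 from the weights and 2 from (n + 2) / (n + 1). *)
apply: (@le_trans _ _ (d.+1%:R / n.+1%:R * 2 *
  (2 * expR 1 * M ^+ 2 * K ^+ n / D ^+ n.+1 * (4 / n.+2%:R)))).
  rewrite !ler_wpM2l ?sum_weights_le // ?mulr_ge0 ?invr_ge0 ?exprn_ge0 //;
    by rewrite ?ltW.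
rewrite [leLHS](_ : _ = M / n.+2%:R * (K / D) ^+ n.+1 * (2^-1 / n.+1%:R)).
  rewrite [leRHS](_ : _ = M / n.+2%:R * (K / D) ^+ n.+1 * n.+2%:R^-1); last first.
    by rewrite expr2 invfM; ring.
  apply: ler_wpM2l.
    by rewrite !mulr_ge0 ?exprn_ge0 ?mulr_ge0 ?invr_ge0 // ltW.
  rewrite -invfM lef_pV2 ?posrE ?mulr_gt0 // n12; lra.
rewrite (expr_div_n K D n.+1) (exprS K n) {2}/K.
move: (exprn_gt0 n.+1 D0); move: (n.+1%:R : R) (n.+2%:R : R) n1 n2 => a b a0 b0.
move: (K ^+ n) (D ^+ n.+1) (expR 1) => A B E B0.
by field; rewrite !gt_eqF.
Qed.

End LevelBounds.

(** * Series in space and time *)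

Section SpaceTimeSeries.
Variables (R : realType) (d : nat).
Local Notation nrm := (index_norm R).
Local Notation I := (nat * 'rV[int]_d)%type.
Implicit Types (a b : I -> R[i]) (t T s : R) (x : 'rV[R]_d).

Definition mode t x (i : I) : R[i] := (t ^+ i.1)%:C * cis (phase i.2 x).

Definition ser a t x : R[i] := csum (fun i => a i * mode t x i).

(** Summability against this weight is absolute convergence for times up to [T]
    on a complex strip of width [s] around the torus. *)
Definition weight T s (i : I) : R := T ^+ i.1 * expR (s * nrm i.2).

Definition wsummable T s a := abs_summable (fun i => weight T s i * normc (a i)).

Lemma weight_ge0 T s i : 0 <= T -> 0 <= weight T s i.
Proof. by move=> T0; rewrite mulr_ge0 ?exprn_ge0 ?expR_ge0. Qed.

Lemma wterm_ge0 T s a i : 0 <= T -> 0 <= weight T s i * normc (a i).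
Proof. by move=> T0; apply: mulr_ge0; [exact: weight_ge0|exact: normc_ge0]. Qed.

Lemma weight_submul T s i j : 0 <= T -> 0 <= s ->
  weight T s (idx_add i j) <= weight T s i * weight T s j.
Proof.
move=> T0 s0; rewrite /weight /= exprD mulrACA ler_wpM2l //.
  by rewrite mulr_ge0 // exprn_ge0.
by rewrite -expRD ler_expR -mulrDr ler_wpM2l // index_normD.
Qed.

Lemma phaseD (k l : 'rV[int]_d) x : phase (k + l) x = phase k x + phase l x.
Proof.
rewrite /phase -big_split; apply: eq_bigr => j _.
by rewrite mxE intrD mulrDl.
Qed.

Lemma modeD t x i j : mode t x (idx_add i j) = mode t x i * mode t x j.
Proof.
by rewrite /mode /= exprD rmorphM /= phaseD cisD; ring.
Qed.

Lemma normc_mode t x i : normc (mode t x i) = `|t| ^+ i.1.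
Proof. by rewrite normcM normc_real normc_cis mulr1 normrX. Qed.

Lemma wsummable_le T s a b : 0 <= T ->
  (forall i, normc (a i) <= normc (b i)) -> wsummable T s b -> wsummable T s a.
Proof.
move=> T0 ab; apply: summable_le => i /=.
by rewrite ger0_norm ?wterm_ge0 // ler_wpM2l ?weight_ge0.
Qed.

Lemma wsummable_mono T T' s s' a : 0 <= T' <= T -> s' <= s ->
  wsummable T s a -> wsummable T' s' a.
Proof.
move=> /andP[T0' TT'] ss'; apply: summable_le => i /=.
rewrite ger0_norm ?wterm_ge0 //.
rewrite ler_wpM2r ?normc_ge0 // ler_pM ?exprn_ge0 ?expR_ge0 //.
  by rewrite lerXn2r // nnegrE // (le_trans T0').
by rewrite ler_expR ler_wpM2r ?index_norm_ge0.
Qed.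

Lemma wsummable_sum T s (J : Type) (r : seq J) (a : J -> I -> R[i]) : 0 <= T ->
  (forall j, wsummable T s (a j)) -> wsummable T s (fun i => \sum_(j <- r) a j i).
Proof.
move=> T0 sa; have : abs_summable (fun i => \sum_(j <- r) weight T s i * normc (a j i)).
  elim: r => [|j r IH].
    rewrite /abs_summable esum1 ?ltry // => i _.
    by rewrite big_nil normr0.
  have -> : (fun i => \sum_(j0 <- j :: r) weight T s i * normc (a j0 i)) =
     (fun i => weight T s i * normc (a j i) +
       \sum_(j0 <- r) weight T s i * normc (a j0 i)).
    by apply/funext => i; rewrite big_cons.
  exact: (abs_summableD (sa j) IH).
apply: summable_le => i /=.
rewrite ger0_norm ?(wterm_ge0 _ (fun i => \sum_(j <- r) a j i)) // -mulr_sumr.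
by rewrite ler_wpM2l ?weight_ge0 // normc_sum.
Qed.

Lemma wsummable_bound T s a : 0 <= T -> 0 <= s -> wsummable T s a ->
  abs_summable (fun i => T ^+ i.1 * normc (a i)).
Proof.
move=> T0 s0; apply: summable_le => i /=.
rewrite ger0_norm ?mulr_ge0 ?exprn_ge0 ?normc_ge0 //.
rewrite ler_wpM2r ?normc_ge0 // ler_peMr ?exprn_ge0 //.
apply: le_trans (expR_ge1Dx _); rewrite lerDl mulr_ge0 //.
exact: index_norm_ge0.
Qed.

Lemma mode_le T t x a i : `|t| <= T ->
  normc (a i * mode t x i) <= T ^+ i.1 * normc (a i).
Proof.
move=> tT; rewrite normcM normc_mode mulrC ler_wpM2r ?normc_ge0 //.
by rewrite lerXn2r // ?nnegrE // (le_trans _ tT).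
Qed.

Lemma csummable_ser T s t x a : `|t| <= T -> 0 <= s -> wsummable T s a ->
  csummable (fun i => a i * mode t x i).
Proof.
move=> tT s0 sa; have T0 : 0 <= T by apply: le_trans tT.
by apply: csummable_le (wsummable_bound T0 s0 sa) => i; exact: mode_le.
Qed.

(** A loss of radius pays for the factor |k|, as in the Cauchy estimate. *)
Lemma wsummable_dxc T s s' j a : 0 <= T -> s' < s -> wsummable T s a ->
  wsummable T s' (dxc j a).
Proof.
move=> T0 ss' /(abs_summableZ (s - s')^-1); apply: summable_le => i /=.
have p : 0 < s - s' by rewrite subr_gt0.
rewrite ger0_norm ?wterm_ge0 //.
rewrite ler_pdivlMl //; apply: le_trans
  (_ : (s - s') * (weight T s' i * (nrm i.2 * normc (a i))) <= _).
  by rewrite ler_wpM2l ?(ltW p) // ler_wpM2l ?weight_ge0 // normc_dxc.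
rewrite !mulrA ler_wpM2r ?normc_ge0 // /weight.
rewrite [leLHS](_ : _ = T ^+ i.1 * (((s - s') * nrm i.2) * expR (s' * nrm i.2))); last by ring.
rewrite ler_wpM2l ?exprn_ge0 //.
rewrite [s * _](_ : _ = (s - s') * nrm i.2 + s' * nrm i.2); last by ring.
rewrite expRD ler_wpM2r ?expR_ge0 //.
by apply: le_trans (expR_ge1Dx _); rewrite lerDr.
Qed.

(** The coefficients of the time derivative. *)
Definition dtc a (i : I) : R[i] := (i.1.+1%:R)%:C * a (i.1.+1, i.2).

(** The derivative of a power at [T'] costs the gap between [T'] and [T]. *)
Lemma pow_deriv_le T T' n : 0 <= T' <= T ->
  n.+1%:R * T' ^+ n * (T - T') <= T ^+ n.+1.
Proof.
move=> /andP[T0 TT']; elim: n => [|n IH].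
  by rewrite expr0 !mul1r expr1 gerBl.
have -> : n.+2%:R * T' ^+ n.+1 * (T - T') =
    T' * (n.+1%:R * T' ^+ n * (T - T')) + T' ^+ n.+1 * (T - T').
  by rewrite -[n.+2%:R]natr1 exprS; ring.
rewrite [leRHS](_ : _ = T' * T ^+ n.+1 + T ^+ n.+1 * (T - T')); last first.
  by rewrite [in LHS]exprS; ring.
apply: lerD; first by rewrite ler_wpM2l.
by rewrite ler_wpM2r ?subr_ge0 // lerXn2r // ?nnegrE // (le_trans T0).
Qed.

Lemma wsummable_dtc T T' s a : 0 <= T' < T -> wsummable T s a ->
  wsummable T' s (dtc a).
Proof.
move=> /andP[T0 TT'] /(abs_summableZ (T - T')^-1).
have p : 0 < T - T' by rewrite subr_gt0.
have ie : injective (fun i : I => (i.1.+1, i.2)) by move=> [? ?] [? ?] [-> ->].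
move=> /(summable_inj ie); apply: summable_le => i /=.
rewrite ger0_norm ?wterm_ge0 //.
rewrite ler_pdivlMl // /dtc normcM normc_real ger0_norm // /weight /=.
have h := pow_deriv_le i.1 (_ : 0 <= T' <= T); rewrite T0 (ltW TT') in h.
rewrite [leLHS](_ : _ = (i.1.+1%:R * T' ^+ i.1 * (T - T')) *
  (expR (s * nrm i.2) * normc (a (i.1.+1, i.2)))); last by ring.
rewrite -[leRHS]mulrA ler_wpM2r ?mulr_ge0 ?expR_ge0 ?normc_ge0 //.
exact: h.
Qed.

Lemma wsummable_convol T s a b : 0 <= T -> 0 <= s ->
  wsummable T s a -> wsummable T s b -> wsummable T s (convol a b).
Proof.
move=> T0 s0; apply: summable_convol => [i|i j]; first exact: weight_ge0.
exact: weight_submul.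
Qed.

Lemma ser_mul T s t x a b : `|t| <= T -> 0 <= s ->
  wsummable T s a -> wsummable T s b ->
  ser a t x * ser b t x = ser (convol a b) t x.
Proof.
move=> tT s0 sa sb; apply: csum_convol.
- exact: modeD.
- exact: csummable_ser sa.
- exact: csummable_ser sb.
Qed.

Lemma ser_sum T s t x (J : Type) (r : seq J) (a : J -> I -> R[i]) :
  `|t| <= T -> 0 <= s -> (forall j, wsummable T s (a j)) ->
  ser (fun i => \sum_(j <- r) a j i) t x = \sum_(j <- r) ser (a j) t x.
Proof.
move=> tT s0 sa.
have sm j : csummable (fun i => a j i * mode t x i) by exact: csummable_ser (sa j).
have [_ <-] := csum_sum r sm.
by apply: eq_csum => i; rewrite mulr_suml.
Qed.

(** For the coefficients of a series, this expresses that the sum is real. *)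
Definition conj_sym a := forall n k, a (n, - k) = conjc (a (n, k)).

Lemma phaseN (k : 'rV[int]_d) x : phase (- k) x = - phase k x.
Proof.
by rewrite -[- k]add0r phaseB /phase big1 ?sub0r // => j _; rewrite mxE mul0r.
Qed.

Lemma conj_sym_ser_conj a t x : conj_sym a -> conjc (ser a t x) = ser a t x.
Proof.
move=> ha; rewrite -csum_conj.
have be : bijective (fun i : I => (i.1, - i.2)).
  by exists (fun i : I => (i.1, - i.2)) => -[n k] /=; rewrite opprK.
rewrite [RHS](csum_reindex _ be); apply: eq_csum => -[n k] /=.
rewrite ha /mode phaseN cisN !rmorphM; congr (_ * (_ * _)).
exact: conjc_real.
Qed.

Lemma real_conj (z : R[i]) : conjc z = z -> (Re z)%:C = z.
Proof. by case: z => u v /= [vv]; congr Complex; lra. Qed.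

Lemma conj_sym_ser a t x : conj_sym a -> (Re (ser a t x))%:C = ser a t x.
Proof. by move=> ha; apply/real_conj/conj_sym_ser_conj. Qed.

Lemma phase_continuous (k : 'rV[int]_d) : continuous (fun x => phase k x).
Proof.
move=> x; apply: (@cvg_sum_seq _ _ (nbhs x) _ _ _
  (fun x j => (k 0 j)%:~R * x 0 j) (fun j => (k 0 j)%:~R * x 0 j)) => j.
by apply: cvgM; [exact: cvg_cst|exact: coord_continuous].
Qed.

Lemma Re_mode a t x i : Re (a i * mode t x i) =
  t ^+ i.1 * (Re (a i) * cos (phase i.2 x) - Im (a i) * sin (phase i.2 x)).
Proof. by rewrite /mode !cReM !cImM /=; ring. Qed.

(** Stated for a filter, so that it covers neighborhoods as well as smaller
    domains; the series converges uniformly for times bounded by [T]. *)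
Lemma ser_continuous T s a : 0 <= T -> 0 <= s -> wsummable T s a ->
  forall (F : set_system (R * 'rV[R]_d)), ProperFilter F ->
  forall z, F --> z -> (\forall y \near F, `|y.1| <= T) ->
  Re (ser a y.1 y.2) @[y --> F] --> Re (ser a z.1 z.2).
Proof.
move=> T0 s0 sa F FF z Fz FT.
apply: (@rsum_cvg _ _ F FF _ (fun y i => Re (a i * mode y.1 y.2 i)) _ _
  (wsummable_bound T0 s0 sa)).
  apply: filterS FT => y yT i; apply: le_trans (normc_Re _) _.
  exact: mode_le.
move=> i; under eq_fun do rewrite Re_mode; rewrite Re_mode.
have c1 : y.1 @[y --> F] --> z.1 by apply: cvg_trans (cvg_fst (F := nbhs z.1) (G := nbhs z.2)); apply: cvg_app; case: z Fz {FT}.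
have c2 : phase i.2 y.2 @[y --> F] --> phase i.2 z.2.
  have c2' : y.2 @[y --> F] --> z.2 by apply: cvg_trans (cvg_snd (F := nbhs z.1) (G := nbhs z.2)); apply: cvg_app; case: z Fz {FT c1}.
  by apply: (cvg_comp _ _ c2'); exact: phase_continuous.
apply: cvgM.
  apply: (@continuous_cvg _ _ _ F _ (fun y => y.1) (fun u : R => u ^+ i.1) z.1) => //.
  exact: exprn_continuous.
apply: cvgB; (apply: cvgM; first exact: cvg_cst).
  apply: (@continuous_cvg _ _ _ F _ (fun y => phase i.2 y.2) cos _ _ c2).
  exact: continuous_cos.
apply: (@continuous_cvg _ _ _ F _ (fun y => phase i.2 y.2) sin _ _ c2).
exact: continuous_sin.
Qed.

End SpaceTimeSeries.

(** * Differentiation of series *)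

Section DerivativeTransfer.
Variable R : realType.

(** Directional derivatives are derivatives along a line, which brings the
    termwise differentiation in one real variable to bear. *)
Lemma is_derive_line (V W : normedModType R) (f : V -> W) (x v : V) (l : W) :
  is_derive (0 : R) 1 (fun h => f (h *: v + x)) l -> is_derive x v f l.
Proof.
move=> [df dl]; split; first exact: (derivable1P f x v).2.
rewrite -dl /derive; set g1 := fun h => h^-1 *: _; set g2 := fun h => h^-1 *: _.
suff -> : g1 = g2 by [].
by apply/funext => h; rewrite /g1 /g2 /= addr0 scale0r add0r [_%:A]mulr1.
Qed.

Lemma is_derive_row (V : normedModType R) m (F : V -> 'rV[R]_m) (x v : V)
    (l : 'I_m -> R) : (forall j, is_derive x v (fun y => F y 0 j) (l j)) ->
  is_derive x v F (\row_j l j).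
Proof.
move=> dF; have dv : derivable F x v.
  by apply/(derivable_mxP F x v).2 => i j; rewrite (ord1 i); have [] := dF j.
split => //; rewrite derive_mx //; apply/rowP => j; rewrite !mxE.
by have [_ ->] := dF j.
Qed.

End DerivativeTransfer.

Section SeriesDerivatives.
Variables (R : realType) (d : nat).
Local Notation nrm := (index_norm R).
Local Notation I := (nat * 'rV[int]_d)%type.
Implicit Types (a : I -> R[i]) (t T s : R) (x : 'rV[R]_d).

(** The derivatives of the terms are summable on a slightly larger interval of
    times; the index of time is then shifted by one. *)
Lemma ser_is_derive_t T s a t x : `|t| < T -> 0 <= s -> wsummable T s a ->
  is_derive t 1 (fun u => Re (ser a u x)) (Re (ser (dtc a) t x)).
Proof.
move=> tT s0 sa.
(* Differentiating needs a time strictly between [t] and [T]. *)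
pose T' := (`|t| + T) / 2.
have tT' : `|t| < T' by rewrite /T'; lra.
have T'T : T' < T by rewrite /T'; lra.
have T'0 : 0 <= T' by apply: le_trans (ltW tT').
pose c (i : I) : R := Re (a i) * cos (phase i.2 x) - Im (a i) * sin (phase i.2 x).
have cle i : `|c i| <= normc (a i).
  have -> : c i = Re (a i * cis (phase i.2 x)) by rewrite cReM.
  by apply: le_trans (normc_Re _) _; rewrite normcM normc_cis mulr1.
pose M (i : I) : R := i.1%:R * T' ^+ i.1.-1 * normc (a i).
have ie : injective (fun i : I => (i.1.+1, i.2)) by move=> [? ?] [? ?] [-> ->].
have off (i : I) : (forall i0 : I, i <> (i0.1.+1, i0.2)) -> i.1 = 0%N.
  by case: i => -[|n] k // /(_ (n, k)).
have sM : abs_summable M.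
  have : wsummable T' s (dtc a) by apply: wsummable_dtc sa; rewrite T'0.
  move=> /(wsummable_bound T'0 s0); rewrite /abs_summable.
  rewrite [in X in _ -> X](esumT_inj ie); last first.
    by move=> i /off i0; rewrite /M i0 !mul0r normr0.
  congr (_ < _)%E; apply: eq_esumT => i; congr (`| _ |%:E).
  by rewrite /M /dtc /= normcM normc_real ger0_norm // mulrCA mulrA.
have -> : (fun u => Re (ser a u x)) = (fun u => rsum (fun i => u ^+ i.1 * c i)).
  by apply/funext => u; rewrite /ser /csum /=; apply: eq_rsum => i; rewrite Re_mode.
have -> : Re (ser (dtc a) t x) = rsum (fun i => i.1%:R * t ^+ i.1.-1 * c i).
  rewrite (rsum_inj ie); last by move=> i /off i0; rewrite i0 !mul0r.
  rewrite /ser /csum /=; apply: eq_rsum => i; rewrite Re_mode /dtc /c cReM cImM /=.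
  by ring.
apply: (@rsum_is_derive _ _ (fun i u => u ^+ i.1 * c i)
  (fun i u => i.1%:R * u ^+ i.1.-1 * c i) M t (T' - `|t|)) => //.
- by rewrite subr_gt0.
- move=> i u _.
  have -> : (fun u : R => u ^+ i.1 * c i) = c i \*: (fun u : R => u ^+ i.1).
    by apply/funext => y; rewrite /GRing.scale /= mulrC.
  have dX : is_derive u 1 (fun u : R => u ^+ i.1) (i.1%:R * u ^+ i.1.-1).
    apply: DeriveDef; first exact: exprn_derivable.
    by rewrite exp_derive /GRing.scale /= mulr1.
  by apply: is_derive_eq; rewrite /GRing.scale /= mulrC.
- move=> i u uT; rewrite normrM /M ler_pM // normrM ger0_norm // ler_wpM2l //.
  rewrite normrX lerXn2r // ?nnegrE //.
  apply: le_trans (_ : `|u - t| + `|t| <= _).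
    by rewrite -{1}(subrK t u) ler_normD.
  by rewrite -lerBrDr ltW.
- have := csummable_Re (csummable_ser x (ltW tT) s0 sa).
  by congr abs_summable; apply/funext => i; rewrite Re_mode.
Qed.

Lemma phase_line (k : 'rV[int]_d) x j (h : R) :
  phase k (h *: basis_vec R j + x) = h * wavenumber R k j + phase k x.
Proof.
rewrite /phase.
have -> : h * wavenumber R k j = \sum_i (k 0 i)%:~R * (h * (i == j)%:R).
  rewrite (bigD1 j) //= eqxx mulr1 big1 => [|i /negbTE ->].
    by rewrite addr0 /wavenumber mulrC.
  by rewrite mulr0 mulr0.
rewrite -big_split; apply: eq_bigr => i _ /=.
by rewrite !mxE eqxx /= mulrDr.
Qed.

Lemma ser_is_derive_x T s a t x j : `|t| <= T -> 0 < s -> wsummable T s a ->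
  is_derive x (basis_vec R j) (fun y => Re (ser a t y)) (Re (ser (dxc j a) t x)).
Proof.
move=> tT s0 sa; have T0 : 0 <= T by apply: le_trans tT.
apply: is_derive_line.
have sM := wsummable_bound T0 (lexx 0) (wsummable_dxc j T0 s0 sa).
have sa' y := csummable_ser y tT (ltW s0) sa.
rewrite [X in is_derive _ _ _ X](_ : _ = rsum (fun i =>
    Re (dxc j a i * mode t (0 *: basis_vec R j + x) i))); last first.
  by rewrite scale0r add0r.
apply: (@rsum_is_derive _ _ (fun i h => Re (a i * mode t (h *: basis_vec R j + x) i))
  (fun i h => Re (dxc j a i * mode t (h *: basis_vec R j + x) i)) _ 0 1 _ sM) => //.
- move=> i h _.
  have -> : (fun h => Re (a i * mode t (h *: basis_vec R j + x) i)) =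
    (fun h => t ^+ i.1 * (Re (a i) * cos (h * wavenumber R i.2 j + phase i.2 x) -
      Im (a i) * sin (h * wavenumber R i.2 j + phase i.2 x))).
    by apply/funext => u; rewrite Re_mode phase_line.
  apply: is_derive_eq; rewrite Re_mode phase_line /dxc cReM cImM /GRing.scale /=.
  by ring.
- move=> i h _; apply: le_trans (normc_Re _) _; exact: mode_le.
- exact: csummable_Re (sa' _).
Qed.

End SeriesDerivatives.

(** * Series at a fixed time *)

Section FixedTime.
Variables (R : realType) (d : nat).
Local Notation nrm := (index_norm R).
Local Notation I := (nat * 'rV[int]_d)%type.
Implicit Types (a : I -> R[i]) (t T s z : R) (x : 'rV[R]_d).

(** The Fourier coefficients of the sum at time [t]. *)
Definition time_coef a t (k : 'rV[int]_d) : R[i] :=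
  csum (fun n => a (n, k) * (t ^+ n)%:C).

Lemma time_coef_norm a t z : 0 <= t ->
  (\esumT_k (expR (z * nrm k) * normc (time_coef a t k))%:E <=
   2%:E * \esumT_i (weight t z i * normc (a i))%:E)%E.
Proof.
move=> t0; have wa0 i : 0 <= weight t z i * normc (a i) by exact: wterm_ge0.
rewrite esumT_pair // esumT_exchange; last by move=> n k; rewrite lee_fin.
rewrite -esumTZ //; last by move=> k; apply: esumT_ge0 => n; rewrite lee_fin.
apply: esumT_le => k; rewrite EFinM.
apply: le_trans (lee_wpmul2l _ (csum_norm _)) _; first by rewrite lee_fin expR_ge0.
rewrite muleCA lee_pmul2l // -esumTZ ?expR_ge0 //; last first.
  by move=> n; rewrite lee_fin normc_ge0.
apply: esumT_le => n; rewrite -EFinM lee_fin normcM normc_real.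
rewrite ger0_norm ?exprn_ge0 // /weight /=.
by rewrite [leLHS](_ : _ = t ^+ n * expR (z * nrm k) * normc (a (n, k))) //; ring.
Qed.

Lemma csummable_time_coef a t z : 0 <= t -> 0 <= z -> wsummable t z a ->
  csummable (time_coef a t).
Proof.
move=> t0 z0 sa; rewrite csummableE.
apply: le_lt_trans (_ : (_ <= \esumT_k (expR (z * nrm k) * normc (time_coef a t k))%:E)%E) _.
  apply: esumT_le => k; rewrite lee_fin ler_peMl ?normc_ge0 //.
  by apply: le_trans (expR_ge1Dx _); rewrite lerDl mulr_ge0 // index_norm_ge0.
apply: le_lt_trans (time_coef_norm a z t0) _.
by rewrite nsumE // -?EFinM ?ltry // => i; exact: wterm_ge0.
Qed.

Lemma ser_trig_series a t z x : 0 <= t -> 0 <= z -> wsummable t z a ->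
  ser a t x = trig_series (time_coef a t) x.
Proof.
move=> t0 z0 sa.
have tt : `|t| <= t by rewrite ger0_norm.
have ss := csummable_ser x tt z0 sa.
have sw : csummable (fun k : 'rV[int]_d * nat => a (k.2, k.1) * mode t x (k.2, k.1)).
  have be : injective (fun k : 'rV[int]_d * nat => (k.2, k.1)) by move=> [? ?] [? ?] [-> ->].
  exact: (csummable_inj be ss).
rewrite /ser csum_pair // csum_exchange; last first.
  by move: ss; congr csummable; apply/funext => -[].
apply: eq_csum => k; rewrite [RHS]mulrC -csumZ.
  by apply: eq_csum => n; rewrite /mode /=; ring.
have [/(_ k) h _] := csummable_pair sw.
have := csummableZ (cis (- phase k x)) h; congr csummable; apply/funext => n.
rewrite /mode /=; transitivity (a (n, k) * (t ^+ n)%:C * (cis (- phase k x) * cis (phase k x))).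
  by ring.
by rewrite -cisD addNr cis0 mulr1.
Qed.

Lemma cis_phase_periodic (k m : 'rV[int]_d) x :
  cis (phase k (x + (2 * pi) *: map_mx intr m)) = cis (phase k x).
Proof.
have -> : phase k (x + (2 * pi) *: map_mx intr m) =
    phase k x + (\sum_j k 0 j * m 0 j)%:~R * (2 * pi).
  rewrite /phase rmorph_sum /= mulr_suml -big_split; apply: eq_bigr => j _ /=.
  by rewrite !mxE rmorphM /=; ring.
by rewrite cisD cis_intr2pi mulr1.
Qed.

Lemma ser_on_torus a t : on_torus (ser a t).
Proof. by move=> x m; apply: eq_csum => i; rewrite /mode cis_phase_periodic. Qed.

Lemma coef_norm_le m (c : 'rV[R[i]]_m) : coef_norm c <= \sum_j normc (c 0 j).
Proof.
have n0 := @normc_ge0 R; have S0 : 0 <= \sum_j normc (c 0 j) by rewrite sumr_ge0.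
rewrite -[leRHS]ger0_norm // -sqrtr_sqr ler_sqrt ?sqr_ge0 // expr2 mulr_suml.
apply: ler_sum => j _; rewrite expr2 ler_wpM2l // (bigD1 j) //= lerDl.
by rewrite sumr_ge0.
Qed.

(** At a time [t], summability against the weight of radius [z] is finiteness
    of the generator function at [z], once the sum over the time index has been
    carried out. *)
Lemma ser_Xspace m (U : 'I_m -> I -> R[i]) t z : 0 <= t -> 0 <= z ->
  (forall j, wsummable t z (U j)) -> (forall j, conj_sym (U j)) ->
  Xspace z (fun x => \row_j Re (ser (U j) t x)).
Proof.
move=> t0 z0 sU hU; set f := fun x => _.
have fE x j : (f x 0 j)%:C = trig_series (time_coef (U j) t) x.
  by rewrite mxE conj_sym_ser // (ser_trig_series x t0 z0).
have sc j := csummable_time_coef t0 z0 (sU j).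
have fc j := fourier_coef_unique (sc j) (fE ^~ j).
split.
- by move=> x k; apply/rowP => j; rewrite !mxE ser_on_torus.
- move=> x j; rewrite fE.
  have -> : (fun k => fourier_coef f k 0 j * cis (phase k x) : R[i]^o) =
      (fun k => time_coef (U j) t k * cis (phase k x)).
    by apply/funext => k; rewrite fc.
  by apply: csum_totally; exact: csummable_phase.
- apply: (@le_lt_trans _ _ (\sum_j \esumT_k
    (expR (z * nrm k) * normc (time_coef (U j) t k))%:E)%E).
    rewrite /Gen -esumT_sum; last by move=> j k; rewrite lee_fin mulr_ge0 ?expR_ge0 ?normc_ge0.
    apply: esumT_le => k; rewrite sumEFin lee_fin -mulr_sumr ler_wpM2l ?expR_ge0 //.
    apply: le_trans (coef_norm_le _) _.
    by apply: ler_sum => j _; rewrite fc.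
  apply: lte_sum_pinfty => j _.
  apply: le_lt_trans (time_coef_norm (U j) z t0) _.
  rewrite nsumE; [by rewrite -EFinM ltry|by move=> i; exact: wterm_ge0|].
  exact: (sU j).
Qed.

End FixedTime.

(** * Continuity *)

Section Topology.
Variable R : realType.

Lemma cvg_row (T : Type) (F : set_system T) (FF : Filter F) m
    (f : T -> 'rV[R]_m) (l : 'rV[R]_m) :
  (forall j, f y 0 j @[y --> F] --> l 0 j) -> f y @[y --> F] --> l.
Proof.
move=> fl; apply/cvgrPdist_le => /= e e0; near=> y.
rewrite /Num.Def.normr /= mx_normrE (bigmax_le _ (ltW e0)) //= => i _.
rewrite !mxE (ord1 i.1); move: i; near: y; apply: filter_forall => /= i.
exact: ((cvgrPdist_le _ _).1 (fl i.2)).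
Unshelve. all: by end_near. Qed.

(** Derivatives are known to be sums of series only for times in an open
    interval; continuity at a point requires no more. *)
Lemma continuous_near_eq (V W : topologicalType) (f g : V -> W) (z : V) :
  (\forall y \near z, f y = g y) -> {for z, continuous g} -> {for z, continuous f}.
Proof.
move=> fg cg; rewrite /prop_for /continuous_at (nbhs_singleton fg).
apply: cvg_trans cg; apply: near_eq_cvg.
by apply: filterS fg => y ->.
Qed.

Lemma near_abs_lt (V : topologicalType) (T : R) (t : R) (x : V) : `|t| < T ->
  \forall z \near ((t, x) : R * V), `|z.1| < T.
Proof.
move=> tT; exists ([set u : R | `|u| < T], setT) => /=; last by case=> u y [].
split; last exact: filterT.
have ct : `|u| @[u --> t] --> `|t| by apply: cvg_norm; exact: cvg_id.
exact: (cvgr_lt _ ct _ tT).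
Qed.

End Topology.

(** * Properties of the coefficients of the solution *)

Section Symmetry.
Variables (R : realType) (d : nat).
Local Notation nrm := (index_norm R).
Local Notation I := (nat * 'rV[int]_d)%type.
Implicit Types (a b : I -> R[i]).

(** The symmetry is proved by induction on the level, so it is stated for the
    levels reached so far. *)
Definition conj_sym_upto n a :=
  forall m k, (m <= n)%N -> a (m, - k) = conjc (a (m, k)).

Lemma conj_sym_convol n a b : conj_sym_upto n a -> conj_sym_upto n b ->
  conj_sym_upto n (convol a b).
Proof.
move=> ha hb m k mn; rewrite /convol -csum_conj.
have be : bijective (fun i : I => (i.1, - i.2)).
  by exists (fun i : I => (i.1, - i.2)) => -[? ?] /=; rewrite opprK.
rewrite (csum_reindex _ be); apply: eq_csum => -[p l] /=.
case: ifP => [pm|_]; last by rewrite conjc0.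
rewrite /idx_sub /= -opprD ha ?(leq_trans pm) // hb ?rmorphM //.
exact: leq_trans (leq_subr _ _) mn.
Qed.

Lemma wavenumberN (k : 'rV[int]_d) j : wavenumber R (- k) j = - wavenumber R k j.
Proof. by rewrite /wavenumber mxE rmorphN. Qed.

Lemma conj_imM (y : R) (z : R[i]) : conjc ((0 +i* y) * z) = (0 +i* (- y)) * conjc z.
Proof. by rewrite rmorphM. Qed.

Lemma conj_realM (y : R) (z : R[i]) : conjc (y%:C * z) = y%:C * conjc z.
Proof. by rewrite rmorphM; congr (_ * _); exact: conjc_real. Qed.

Lemma conj_opp (z : R[i]) : conjc (- z) = - conjc z.
Proof. by case: z. Qed.

Lemma conj_sub (z w : R[i]) : conjc (z - w) = conjc z - conjc w.
Proof. by case: z; case: w => a b c e; apply: eq_ReIm => //=; ring. Qed.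

Lemma conj_sum (J : Type) (r : seq J) (F : J -> R[i]) :
  conjc (\sum_(j <- r) F j) = \sum_(j <- r) conjc (F j).
Proof. exact: rmorph_sum. Qed.

Lemma conj_sym_dxc n j a : conj_sym_upto n a -> conj_sym_upto n (dxc j a).
Proof.
by move=> ha m k mn; rewrite /dxc conj_imM /= wavenumberN ha.
Qed.

Variables (c0 : 'I_d -> 'rV[int]_d -> R[i]) (U : 'I_d -> I -> R[i]).
Hypothesis hU : velocity_recursion c0 U.

Lemma conj_sym_nonlin n j : (forall l, conj_sym_upto n (U l)) ->
  conj_sym_upto n (nonlin U j).
Proof.
move=> sU m k mn; rewrite /nonlin conj_sum; apply: eq_bigr => l _.
by rewrite (@conj_sym_convol n) //; exact: conj_sym_dxc.
Qed.

Lemma kdotN (k : 'rV[int]_d) (N : 'I_d -> R[i]) :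
  kdot (- k) (fun l => conjc (N l)) = - conjc (kdot k N).
Proof.
rewrite /kdot conj_sum -sumrN; apply: eq_bigr => l _.
by rewrite wavenumberN conj_realM rmorphN mulNr.
Qed.

Lemma lerayN (k : 'rV[int]_d) (N : 'I_d -> R[i]) j :
  leray (- k) (fun l => conjc (N l)) j = conjc (leray k N j).
Proof.
rewrite /leray kdotN wavenumberN index_normN conj_sub conj_realM.
by rewrite mulNr rmorphN mulrNN.
Qed.

Lemma velocity_conj_sym : (forall j k, c0 j (- k) = conjc (c0 j k)) ->
  forall j, conj_sym (U j).
Proof.
case: hU => hU0 hUS sc0.
have H n : forall j, conj_sym_upto n (U j).
  elim: n => [|n IH] j m k; first by rewrite leqn0 => /eqP ->; rewrite !hU0.
  rewrite leq_eqVlt => /orP[/eqP ->|]; last by rewrite ltnS; exact: IH.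
  rewrite !hUS !mulNr conj_opp conj_realM -lerayN; congr (- (_ * leray _ _ _)).
  by apply/funext => l; exact: (@conj_sym_nonlin n).
by move=> j n k; exact: (H n).
Qed.

(** Solves the gradient part of the momentum equation for the pressure; at
    k = 0, division by zero selects the pressure with mean zero. *)
Definition pressure_coef (i : I) : R[i] :=
  (0 +i* (nrm i.2 ^+ 2)^-1) * kdot i.2 (fun l => nonlin U l i).

Lemma pressure_conj_sym : (forall j, conj_sym (U j)) -> conj_sym pressure_coef.
Proof.
move=> sU n k; rewrite /pressure_coef conj_imM index_normN.
have -> : (fun l => nonlin U l (n, - k)) = (fun l => conjc (nonlin U l (n, k))).
  by apply/funext => l; apply: (@conj_sym_nonlin n) => // l' m k' _; exact: sU.
rewrite kdotN.
have key (y : R) (q : R[i]) : (0 +i* y) * (- q) = (0 +i* (- y)) * q.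
  by case: q => u v; apply: eq_ReIm => /=; ring.
exact: key.
Qed.

Lemma pressure_coef_le i : normc (pressure_coef i) <= \sum_l normc (nonlin U l i).
Proof.
have S0 : 0 <= \sum_l normc (nonlin U l i).
  by apply: sumr_ge0 => l _; exact: normc_ge0.
rewrite normcM /= expr0n add0r sqrtr_sqr normfV (ger0_norm (sqr_ge0 _)).
have [->|k0] := eqVneq i.2 0.
  rewrite (_ : nrm 0 = 0) ?expr0n ?invr0 ?mul0r //.
  by rewrite /index_norm big1 ?sqrtr0 // => j _; rewrite mxE expr0n.
have k1 := index_norm_ge1 R k0; have kp : 0 < nrm i.2 by apply: lt_le_trans k1.
rewrite mulrC ler_pdivrMr ?exprn_gt0 //; apply: le_trans (kdot_norm _ _) _.
by rewrite mulrC ler_wpM2l // expr2 ler_peMl // ltW.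
Qed.

(** The pressure gradient is exactly what the Leray projection removes from
    the nonlinear term. *)
Lemma momentum_coef j i :
  dtc (U j) i + nonlin U j i + dxc j pressure_coef i = 0.
Proof.
case: i => n k; rewrite /dtc /dxc /pressure_coef /=; case: hU => _ ->.
rewrite /leray; move: (kdot _ _) (nonlin U j (n, k)) => q N.
have n1 : n.+1%:R != 0 :> R by rewrite pnatr_eq0.
move: (n.+1%:R : R) n1 (nrm k ^+ 2)^-1 (wavenumber R k j) => m m0 v y.
rewrite mulNr mulrN (mulrA m%:C) -rmorphM /= mulfV // mul1r.
by case: q N => [a b] [e f]; apply: eq_ReIm;
  rewrite ?(cReM, cImM, cReD, cImD, cReN, cImN) /=;
  rewrite ?(cReM, cImM, cReD, cImD, cReN, cImN) /=; ring.
Qed.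

(** The projection annihilates the divergence at every positive level; at level
    0 this is the hypothesis on the data. *)
Lemma divergence_coef i : (forall k, kdot k (c0 ^~ k) = 0) ->
  \sum_j dxc j (U j) i = 0.
Proof.
move=> hc0; case: i => n k; case: hU => hU0 hUS.
have -> : \sum_j dxc j (U j) (n, k) = (0 +i* 1) * kdot k (fun j => U j (n, k)).
  rewrite /kdot mulr_sumr; apply: eq_bigr => j _; rewrite /dxc mulrA; congr (_ * _).
  by apply: eq_ReIm; rewrite ?cReM ?cImM /=; ring.
case: n => [|n].
  rewrite (_ : (fun j => U j (0%N, k)) = c0 ^~ k) ?hc0 ?mulr0 //.
  by apply/funext => j; rewrite hU0.
have [->|k0] := eqVneq k 0.
  rewrite /kdot big1 ?mulr0 // => l _; rewrite /wavenumber mxE.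
  by rewrite (_ : (0%:~R)%:C = 0 :> R[i]) ?mul0r.
have -> : (fun j => U j (n.+1, k)) =
    (fun j => - (n.+1%:R^-1)%:C * leray k (fun l => nonlin U l (n, k)) j).
  by apply/funext => j; rewrite hUS.
rewrite /kdot; under eq_bigr do rewrite mulrCA.
by rewrite -mulr_sumr -/(kdot k _) kdot_leray // !mulr0.
Qed.

(** The terms at level n are bounded by a geometric progression of ratio
    T K / (rho - z). *)
Lemma wsummable_velocity (rho M T z : R) : 0 < M ->
  (level_norm U 0 rho <= M%:E)%E -> let K := 32 * d.+1%:R * expR 1 * M in
  0 <= T -> 0 <= z -> z < rho -> T * K < rho - z ->
  forall j, wsummable T z (U j).
Proof.
move=> M0 hM K T0 z0 zr TK j.
have D0 : 0 < rho - z by rewrite subr_gt0.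
have K0 : 0 <= K by rewrite !mulr_ge0 ?expR_ge0 // ltW.
have q01 : 0 <= T * K / (rho - z) < 1.
  apply/andP; split; last by rewrite ltr_pdivrMr // mul1r.
  by apply: divr_ge0; [exact: mulr_ge0|exact: ltW].
have wa0 i : 0 <= weight T z i * normc (U j i) by exact: wterm_ge0.
apply: summable_fin => //.
have sg := geometric_summable (ltW M0) q01.
apply: (@le_lt_trans _ _ (\esumT_n (M * (T * K / (rho - z)) ^+ n)%:E)); last first.
  rewrite nsumE ?ltry // => n; rewrite mulr_ge0 ?(ltW M0) // exprn_ge0 //.
  by case/andP: q01.
rewrite esumT_pair //; apply: esumT_le => n.
apply: (@le_trans _ _ ((T ^+ n)%:E * level_norm U n z)%E).
  rewrite -esumTZ ?exprn_ge0 //; last first.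
    move=> k; rewrite lee_fin mulr_ge0 ?expR_ge0 // sumr_ge0 // => l _.
    exact: normc_ge0.
  apply: esumT_le => k; rewrite -EFinM lee_fin /weight /= -mulrA.
  rewrite ler_wpM2l ?exprn_ge0 // ler_wpM2l ?expR_ge0 //.
  rewrite (bigD1 j) //= lerDl sumr_ge0 // => l _; exact: normc_ge0.
have h := level_norm_bound hU M0 hM n z0 zr.
apply: le_trans (lee_wpmul2l _ h) _; first by rewrite lee_fin exprn_ge0.
rewrite -EFinM lee_fin -/K.
have -> : M * (T * K / (rho - z)) ^+ n = T ^+ n * (M * (K / (rho - z)) ^+ n).
  by rewrite -mulrA exprMn mulrCA.
have Kz : 0 <= (K / (rho - z)) ^+ n.
  by apply/exprn_ge0/divr_ge0 => //; exact: ltW.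
apply: ler_wpM2l; first exact: exprn_ge0.
apply: ler_wpM2r => //; rewrite ler_pdivrMr ?exprn_gt0 ?ltr0n //.
by rewrite ler_peMr ?(ltW M0) // exprn_ege1 // ler1n.
Qed.

End Symmetry.

(** * The initial data *)

Section InitialData.
Variables (R : realType) (d : nat).
Local Notation nrm := (index_norm R).
Local Notation I := (nat * 'rV[int]_d)%type.

(** The coefficients of a series with sum 0 and those of the zero series are
    both the Fourier coefficients of the zero function. *)
Lemma trig_series_eq0 (c : 'rV[int]_d -> R[i]) : csummable c ->
  (forall x, trig_series c x = 0) -> forall k, c k = 0.
Proof.
move=> sc c0 k.
pose f (x : 'rV[R]_d) : 'rV[R]_1 := 0.
have f0 x : (f x 0 0)%:C = 0 by rewrite mxE.
have s0 : csummable (fun _ : 'rV[int]_d => 0 : R[i]).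
  by rewrite csummableE esum1 ?ltry // => i _; rewrite normc_zero.
rewrite -(@fourier_coef_unique _ _ _ f 0 c sc); last by move=> x; rewrite f0 c0.
rewrite (@fourier_coef_unique _ _ _ f 0 _ s0) // => x.
by rewrite f0 -[LHS](csum0 R 'rV[int]_d); apply: eq_csum => l; rewrite mul0r.
Qed.

Variables (rho : R) (u0 : 'rV[R]_d -> 'rV[R]_d).
Hypotheses (hrho : 0 < rho) (hu0 : Xspace rho u0).

Definition init_coef (j : 'I_d) (k : 'rV[int]_d) : R[i] := fourier_coef u0 k 0 j.

Lemma normc_le_coef_norm m (c : 'rV[R[i]]_m) j : normc (c 0 j) <= coef_norm c.
Proof.
rewrite -[leLHS]ger0_norm ?normc_ge0 // -sqrtr_sqr ler_sqrt; last first.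
  by rewrite sumr_ge0 // => i _; exact: sqr_ge0.
by rewrite (bigD1 j) //= lerDl sumr_ge0 // => i _; exact: sqr_ge0.
Qed.

Lemma init_norm_finite : exists2 M : R, 0 < M &
  (\esumT_k (expR (rho * nrm k) * \sum_j normc (init_coef j k))%:E <= M%:E)%E.
Proof.
case: hu0 => _ _ hG.
pose S := \esumT_k (expR (rho * nrm k) * \sum_j normc (init_coef j k))%:E.
have S0 : (0 <= S)%E.
  apply: esumT_ge0 => k; rewrite lee_fin mulr_ge0 ?expR_ge0 // sumr_ge0 // => j _.
  exact: normc_ge0.
have Sfin : (S < +oo)%E.
  apply: (@le_lt_trans _ _ (d%:R%:E * Gen u0 rho)%E).
    rewrite /Gen -esumTZ //; last first.
      by move=> k; rewrite lee_fin mulr_ge0 ?expR_ge0 // sqrtr_ge0.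
    apply: esumT_le => k; rewrite -EFinM lee_fin mulrCA ler_wpM2l ?expR_ge0 //.
    apply: (@le_trans _ _ (\sum_(j < d) coef_norm (fourier_coef u0 k))).
      by apply: ler_sum => j _; exact: normc_le_coef_norm.
    by rewrite sumr_const card_ord mulr_natl.
  have G0 : (0 <= Gen u0 rho)%E.
    by apply: esumT_ge0 => k; rewrite lee_fin mulr_ge0 ?expR_ge0 // sqrtr_ge0.
  by rewrite -(@fineK _ (Gen u0 rho)) ?ge0_fin_numE // -EFinM ltry.
exists (fine S + 1); first by rewrite ltr_wpDl // fine_ge0.
by rewrite EFinD fineK ?ge0_fin_numE // leeDl // lee_fin.
Qed.

Lemma init_coef_summable j : csummable (init_coef j).
Proof.
have [M M0 hM] := init_norm_finite.
rewrite csummableE; apply: le_lt_trans (ltry M); apply: le_trans hM.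
apply: esumT_le => k; rewrite lee_fin.
have e1 : 1 <= expR (rho * nrm k).
  by apply: le_trans (expR_ge1Dx _); rewrite lerDl mulr_ge0 ?index_norm_ge0 // ltW.
apply: (@le_trans _ _ (\sum_j normc (init_coef j k))).
  by rewrite (bigD1 j) //= lerDl sumr_ge0 // => l _; exact: normc_ge0.
by rewrite ler_peMl // sumr_ge0 // => l _; exact: normc_ge0.
Qed.

Lemma init_trig_series x j : (u0 x 0 j)%:C = trig_series (init_coef j) x.
Proof.
case: hu0 => _ hS _; symmetry; apply: csum_unique; last exact: hS.
exact/csummable_phase/init_coef_summable.
Qed.

(** Conjugating the series of a real function gives another series with the same
    sum, hence the same coefficients. *)
Lemma init_conj_sym j k : init_coef j (- k) = conjc (init_coef j k).
Proof.
pose c l := conjc (init_coef j (- l)).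
have be : bijective (fun l : 'rV[int]_d => - l) by exists (fun l => - l) => l; rewrite opprK.
have sc : csummable c.
  have := csummable_inj (bij_inj be) (init_coef_summable j).
  by apply: csummable_le => l; rewrite normc_conj.
suff -> : init_coef j k = c k by rewrite /c conjcK.
apply: (fourier_coef_unique sc) => x.
rewrite -conjc_real init_trig_series /trig_series -csum_conj.
rewrite (csum_reindex _ be); apply: eq_csum => l.
rewrite /c phaseN cisN rmorphM; congr (_ * _).
exact: conjcK.
Qed.

End InitialData.

(** * The solution *)

Section Construction.
Variables (R : realType) (d : nat).
Local Notation I := (nat * 'rV[int]_d)%type.
Variables (rho M : R) (u0 : 'rV[R]_d -> 'rV[R]_d).
Hypotheses (hrho : 0 < rho) (hu0 : Xspace rho u0) (hdiv : divergence_free u0).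
Hypothesis M0 : 0 < M.
Hypothesis hM : (\esumT_k (expR (rho * index_norm R k) *
   \sum_j normc (init_coef u0 j k))%:E <= M%:E)%E.

Let U := velocity_coef (init_coef u0).
Let P := pressure_coef U.
Let K : R := 32 * d.+1%:R * expR 1 * M.

Let hU : velocity_recursion (init_coef u0) U.
Proof. exact: velocity_coef_recursion. Qed.

Let K0 : 0 < K.
Proof. by rewrite !mulr_gt0 // expR_gt0. Qed.

Let hM' : (level_norm U 0 rho <= M%:E)%E.
Proof.
apply: le_trans hM; apply: esumT_le => k; rewrite lee_fin.
by apply: ler_wpM2l; [exact: expR_ge0|apply: ler_sum => j _; rewrite hU.1].
Qed.

Definition velocity t (x : 'rV[R]_d) : 'rV[R]_d := \row_j Re (ser (U j) t x).

Definition pressure t (x : 'rV[R]_d) : R := Re (ser P t x).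

Let sU T z : 0 <= T -> 0 <= z -> z < rho -> T * K < rho - z ->
  forall j, wsummable T z (U j).
Proof. exact: (wsummable_velocity hU M0 hM'). Qed.

Let cU j : conj_sym (U j).
Proof. exact: (velocity_conj_sym hU (init_conj_sym hrho hu0)). Qed.

Let cP : conj_sym P.
Proof. exact: pressure_conj_sym. Qed.

Lemma conj_sym_dxc_all j (a : I -> R[i]) : conj_sym a -> conj_sym (dxc j a).
Proof.
move=> ca n k; apply: (@conj_sym_dxc _ _ n) => // m l _; exact: ca.
Qed.

Lemma conj_sym_sum (J : Type) (r : seq J) (a : J -> I -> R[i]) :
  (forall j, conj_sym (a j)) -> conj_sym (fun i => \sum_(j <- r) a j i).
Proof.
by move=> ca n k; rewrite conj_sum; apply: eq_bigr => j _; rewrite ca.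
Qed.

Lemma velocity_real t x j : (velocity t x 0 j)%:C = ser (U j) t x.
Proof. by rewrite mxE conj_sym_ser. Qed.

Lemma velocity0 : velocity 0 = u0.
Proof.
apply/funext => x; apply/rowP => j; apply: complexI.
rewrite velocity_real (init_trig_series hrho hu0).
have sw : wsummable 0 0 (U j) by apply: sU => //; rewrite mul0r subr0.
rewrite (ser_trig_series x (lexx 0) (lexx 0) sw); apply: eq_csum => k.
congr (_ * _); rewrite /time_coef (csum_single (i0 := 0%N)).
  by rewrite hU.1 expr0 mulr1.
by case=> // n _; rewrite exprS mul0r mulr0.
Qed.

(** Times up to rho / (4 K) are needed and the radius rho / 2 allows all times
    below rho / (2 K); [T2] < [T1] lie in between, [T2] leaving room for a time
    derivative. Likewise the radii rho / 2, rho / 3 and rho / 4 leave room for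
    the two derivatives in space, of the velocity and of the pressure. *)
Let T1 : R := 3 * rho / (8 * K).
Let T2 : R := 5 * rho / (16 * K).

Let T1_gt0 : 0 < T1.
Proof. by rewrite divr_gt0 // mulr_gt0. Qed.

Let T2_gt0 : 0 < T2.
Proof. by rewrite divr_gt0 // mulr_gt0. Qed.

Let T2_lt_T1 : T2 < T1.
Proof.
have -> : T2 = 5 / 6 * T1 by rewrite /T1 /T2; field; rewrite gt_eqF.
by rewrite gtr_pMl //; lra.
Qed.

Let T1_ge0 : 0 <= T1. Proof. exact: ltW. Qed.

Let T2_ge0 : 0 <= T2. Proof. exact: ltW. Qed.

Let lt_T1 (t : R) : `|t| < T2 -> `|t| < T1.
Proof. by move=> tT; exact: lt_trans T2_lt_T1. Qed.

Let sU1 j : wsummable T1 (rho / 2) (U j).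
Proof.
apply: sU => //; [by rewrite divr_ge0 // ltW|by rewrite ltr_pdivrMr // ltr_pMr // ltr1n|].
have -> : T1 * K = 3 / 8 * rho by rewrite /T1; field; rewrite gt_eqF.
have := hrho; lra.
Qed.

Let s1_ge0 : 0 <= rho / 3. Proof. by rewrite divr_ge0 // ltW. Qed.

Let s2_ge0 : 0 <= rho / 4. Proof. by rewrite divr_ge0 // ltW. Qed.

Let sU3 j : wsummable T1 (rho / 3) (U j).
Proof. by apply: wsummable_mono (sU1 j); [rewrite lexx T1_ge0|have := hrho; lra]. Qed.

Let sdU j l : wsummable T1 (rho / 3) (dxc l (U j)).
Proof. by apply: wsummable_dxc (sU1 j) => //; have := hrho; lra. Qed.

Let sN j : wsummable T1 (rho / 3) (nonlin U j).
Proof. by apply: wsummable_sum => // l; exact: wsummable_convol. Qed.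

Let sP : wsummable T1 (rho / 3) P.
Proof.
apply: (@wsummable_le _ _ _ _ _ (fun i => \sum_l (normc (nonlin U l i))%:C)) => //.
  move=> i; rewrite -rmorph_sum /= -[X in _ <= X]/(normc (_%:C)) normc_real.
  by apply: le_trans (pressure_coef_le U i) _; exact: ler_norm.
apply: wsummable_sum => // l; apply: wsummable_le (sN l) => // i.
by rewrite normc_real ger0_norm ?normc_ge0.
Qed.

Let sdP l : wsummable T1 (rho / 4) (dxc l P).
Proof. by apply: wsummable_dxc sP => //; have := hrho; lra. Qed.

Let stU j : wsummable T2 (rho / 3) (dtc (U j)).
Proof. by apply: wsummable_dtc (sU3 j); rewrite T2_ge0 T2_lt_T1. Qed.

Lemma velocity_derive_t (t : R) x : `|t| < T2 ->
  is_derive t 1 (velocity ^~ x) (\row_j Re (ser (dtc (U j)) t x)).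
Proof.
move=> tT; apply: is_derive_row => j.
have -> : (fun s => velocity s x 0 j) = (fun s => Re (ser (U j) s x)).
  by apply/funext => s; rewrite mxE.
exact: ser_is_derive_t (lt_T1 tT) _ (sU3 j).
Qed.

Lemma velocity_comp_derive_x (t : R) x l j : `|t| < T2 ->
  is_derive x (basis_vec R l) (fun y => velocity t y 0 j)
    (Re (ser (dxc l (U j)) t x)).
Proof.
move=> tT; have -> : (fun y => velocity t y 0 j) = (fun y => Re (ser (U j) t y)).
  by apply/funext => y; rewrite mxE.
by apply: ser_is_derive_x (ltW (lt_T1 tT)) _ (sU1 j); rewrite divr_gt0.
Qed.

Lemma velocity_derive_x (t : R) x l : `|t| < T2 ->
  is_derive x (basis_vec R l) (velocity t) (\row_j Re (ser (dxc l (U j)) t x)).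
Proof. by move=> tT; apply: is_derive_row => j; exact: velocity_comp_derive_x. Qed.

Lemma pressure_derive_x (t : R) x l : `|t| < T2 ->
  is_derive x (basis_vec R l) (pressure t) (Re (ser (dxc l P) t x)).
Proof.
by move=> tT; apply: ser_is_derive_x (ltW (lt_T1 tT)) _ sP; rewrite divr_gt0.
Qed.

Lemma ser_continuous_at T s (a : I -> R[i]) (t : R) x : 0 <= s -> `|t| < T ->
  wsummable T s a ->
  {for (t, x), continuous (fun z : R * 'rV[R]_d => Re (ser a z.1 z.2))}.
Proof.
move=> s0 tT sa; have T0 : 0 <= T by apply: le_trans (ltW tT).
apply: (ser_continuous T0 s0 sa (F := nbhs ((t, x) : R * 'rV[R]_d))).
  exact: cvg_id.
by apply: filterS (near_abs_lt x tT) => z /ltW.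
Qed.

Lemma row_ser_continuous_at m T s (a : 'I_m -> I -> R[i]) (t : R) x : 0 <= s ->
  `|t| < T -> (forall j, wsummable T s (a j)) ->
  {for (t, x), continuous
    (fun z : R * 'rV[R]_d => (\row_j Re (ser (a j) z.1 z.2) : 'rV[R]_m))}.
Proof.
move=> s0 tT sa; apply: cvg_row => j; rewrite mxE.
under eq_fun do rewrite mxE.
exact: ser_continuous_at (sa j).
Qed.

Lemma divergenceE (t : R) x : `|t| < T2 ->
  divergence (velocity t) x = Re (ser (fun i => \sum_j dxc j (U j) i) t x).
Proof.
move=> tT; rewrite (ser_sum x _ (ltW (lt_T1 tT)) s1_ge0 (fun j => sdU j j)) Re_sum.
apply: eq_bigr => j _.
by have [_ ->] := velocity_comp_derive_x x j j tT.
Qed.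

(** At time 0 the divergence is a series whose coefficients are i k . U(0, k);
    its sum vanishes by hypothesis, hence so do the coefficients. *)
Lemma init_kdot k : kdot k (init_coef u0 ^~ k) = 0.
Proof.
pose D (i : I) := \sum_j dxc j (U j) i.
have sD : wsummable 0 0 D.
  by apply: wsummable_sum => // j; apply: wsummable_mono (sdU j j); rewrite ?lexx.
have cD : conj_sym D by apply: conj_sym_sum => j; exact: conj_sym_dxc_all.
have D0 x : trig_series (time_coef D 0) x = 0.
  rewrite -(ser_trig_series x (lexx 0) (lexx 0) sD) -(conj_sym_ser _ _ cD).
  rewrite -divergenceE ?normr0 // velocity0.
  by rewrite hdiv.
have := trig_series_eq0 (csummable_time_coef (lexx 0) (lexx 0) sD) D0 k.
rewrite /time_coef (csum_single (i0 := 0%N)); last first.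
  by case=> // n _; rewrite exprS mul0r mulr0.
rewrite expr0 mulr1 /D.
have -> : \sum_j dxc j (U j) (0%N, k) = (0 +i* 1) * kdot k (init_coef u0 ^~ k).
  rewrite /kdot mulr_sumr; apply: eq_bigr => j _; rewrite /dxc mulrA hU.1.
  by congr (_ * _); apply: eq_ReIm; rewrite ?cReM ?cImM /=; ring.
move/eqP; rewrite mulf_eq0 => /orP[|/eqP //].
by rewrite eq_complex /= oner_eq0 andbF.
Qed.

Lemma velocity_divergence_free (t : R) : `|t| < T2 -> divergence_free (velocity t).
Proof.
move=> tT x; rewrite divergenceE // /ser.
rewrite (eq_csum (b := fun=> 0)) ?csum0 // => i.
by rewrite (divergence_coef hU) ?mul0r //; exact: init_kdot.
Qed.

Lemma velocity_momentum (t : R) x : `|t| < T2 ->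
  'D_1 (velocity ^~ x) t + advection (velocity t) (velocity t) x +
    gradient (pressure t) x = 0.
Proof.
move=> tT; have tT1 := ltW (lt_T1 tT).
have [_ ->] := velocity_derive_t x tT.
apply/rowP => j; rewrite !mxE /advection summxE.
have [_ ->] := pressure_derive_x x j tT.
have -> : \sum_l (velocity t x 0 l *: 'D_(basis_vec R l) (velocity t) x) 0 j =
    Re (ser (nonlin U j) t x).
  rewrite (ser_sum x _ tT1 s1_ge0 (fun l => wsummable_convol T1_ge0 s1_ge0 (sU3 l) (sdU j l))).
  rewrite Re_sum; apply: eq_bigr => l _.
  have [_ ->] := velocity_derive_x x l tT; rewrite !mxE.
  rewrite -(ser_mul x tT1 s1_ge0 (sU3 l) (sdU j l)) -velocity_real.
  by rewrite cReM /= mul0r subr0 mxE.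
rewrite -!cReD /ser.
have s1 : csummable (fun i => dtc (U j) i * mode t x i).
  exact: csummable_ser (ltW tT) s1_ge0 (stU j).
have s2 : csummable (fun i => nonlin U j i * mode t x i).
  exact: csummable_ser tT1 s1_ge0 (sN j).
have s3 : csummable (fun i => dxc j P i * mode t x i).
  exact: csummable_ser tT1 s2_ge0 (sdP j).
rewrite -csumD // -csumD //; last exact: csummableD.
rewrite (eq_csum (b := fun=> 0)) ?csum0 // => i.
by rewrite -!mulrDl (momentum_coef hU) mul0r.
Qed.

Lemma euler_solution_construction (J : set R) :
  (forall t, J t -> `|t| < T2) -> euler_solution J u0 velocity pressure.
Proof.
move=> JT.
have near_formula (V W : topologicalType) (f g : R * V -> W) t x : J t ->
    (forall z : R * V, `|z.1| < T2 -> f z = g z) ->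
    {for (t, x), continuous g} -> {for (t, x), continuous f}.
  move=> Jt fg; apply: continuous_near_eq.
  by apply: filterS (near_abs_lt x (JT t Jt)) => z; exact: fg.
split.
- by move=> t Jt x k; apply/rowP => j; rewrite !mxE ser_on_torus.
- by move=> t Jt _ x k; rewrite /pressure ser_on_torus.
- apply: continuous_in_subspaceT => -[t x] /set_mem [/= Jt _].
  exact: row_ser_continuous_at s1_ge0 (lt_T1 (JT t Jt)) sU3.
- by move=> t x Jt _; have [] := velocity_derive_t x (JT t Jt).
- by move=> t x l Jt _; have [] := velocity_derive_x x l (JT t Jt).
- move=> t x Jt _.
  apply: (near_formula _ _ _ (fun z => \row_j Re (ser (dtc (U j)) z.1 z.2))) => //.
    by move=> z zT; have [_ ->] := velocity_derive_t z.2 zT.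
  exact: row_ser_continuous_at s1_ge0 (JT t Jt) stU.
- move=> t x l Jt _.
  apply: (near_formula _ _ _ (fun z => \row_j Re (ser (dxc l (U j)) z.1 z.2))) => //.
    by move=> z zT; have [_ ->] := velocity_derive_x z.2 l zT.
  exact: row_ser_continuous_at s1_ge0 (lt_T1 (JT t Jt)) (sdU ^~ l).
- move=> t x Jt _; exact: ser_continuous_at s1_ge0 (lt_T1 (JT t Jt)) sP.
- by move=> t x l Jt _; have [] := pressure_derive_x x l (JT t Jt).
- move=> t x Jt _.
  apply: (near_formula _ _ _ (fun z => \row_l Re (ser (dxc l P) z.1 z.2))) => //.
    move=> z zT; apply/rowP => l; rewrite !mxE.
    by have [_ ->] := pressure_derive_x z.2 l zT.
  exact: row_ser_continuous_at s2_ge0 (lt_T1 (JT t Jt)) sdP.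
- by move=> t x Jt _; exact: velocity_momentum (JT t Jt).
- by move=> t Jt; exact: velocity_divergence_free (JT t Jt).
- exact: velocity0.
Qed.

Lemma velocity_Xspace t z : 0 <= t -> 0 <= z -> z < rho -> t * K < rho - z ->
  Xspace z (velocity t).
Proof. by move=> t0 z0 zr tK; apply: ser_Xspace => //; exact: sU. Qed.

Lemma velocity_lifespan (t : R) : 0 <= t -> 0 < rho - 4 * K * t -> `|t| < T2.
Proof.
move=> t0 h; rewrite ger0_norm // /T2 ltr_pdivlMr ?mulr_gt0 //.
have := hrho; lra.
Qed.

End Construction.

Theorem theorem3p1 (R : realType) (d : nat) (hd : (2 <= d)%N)
    (rho : R) (hrho : 0 < rho)
    (u0 : 'rV[R]_d -> 'rV[R]_d) (hu0 : Xspace rho u0)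
    (hdiv : divergence_free u0) :
  exists C1 : R, 0 < C1 /\
    let rho_ (t : R) := rho - C1 * t in
    let J := [set t : R | 0 <= t /\ 0 < rho_ t] in
    exists (u : R -> 'rV[R]_d -> 'rV[R]_d) (p : R -> 'rV[R]_d -> R),
      euler_solution J u0 u p /\ (forall t, J t -> Xspace (rho_ t) (u t)).
Proof.
(* With this constant, K t / (rho - rho(t)) = 1 / 4 for t > 0. *)
have [M M0 hM] := init_norm_finite hu0.
pose K : R := 32 * d.+1%:R * expR 1 * M.
have K0 : 0 < K by rewrite !mulr_gt0 // expR_gt0.
exists (4 * K); split; first by rewrite mulr_gt0.
move=> rho_ J; exists (velocity u0), (pressure u0); split.
  apply: (euler_solution_construction hrho hu0 hdiv M0 hM) => t [t0 tr].
  exact: velocity_lifespan t0 tr.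
move=> t [t0 tr]; have [t_eq0|t_neq0] := eqVneq t 0.
  by rewrite /rho_ t_eq0 mulr0 subr0 (velocity0 hrho hu0 M0 hM).
have t_gt0 : 0 < t by rewrite lt0r t_neq0.
apply: (velocity_Xspace hrho hu0 M0 hM); rewrite // -/K /rho_ -mulrA.
- by move: tr; rewrite /rho_ -mulrA => /ltW.
- by rewrite gtrBl !mulr_gt0.
- by rewrite opprB addrC subrK [t * K]mulrC ltr_pMl ?mulr_gt0 // ltr1n.
Qed.
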